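(* For any $k\geq 2$ and integers $m_1,\dots,m_k\geq 1$, the number of equivalent embeddings of the cubic caterpillar-Halin graph $H_{m_1,\dots,m_k}$ into surfaces of Euler-genus $2$ is $$\varepsilon_{m_1,\dots,m_k}(2)=8\sum_{i=1}^k\Big(-9+4i+(-3+4i)m_i+2m_i^2\Big)+2\sum_{i=2}^k\big(2^{m_i+3}+3\cdot 2^{m_{i-1}+3}\big)-2^{m_1+5}+32\sum_{i=2}^k\sum_{j=1}^{i-1}(m_jm_i+m_j).$$
   Context: Counting embeddings. The Euler-genus of a closed surface is $2j$ for the orientable surface with $j$ handles and $c$ for the non-orientable surface with $c$ crosscaps. A pure rotation system of a graph $G$ assigns to every vertex a cyclic permutation of its incident edges; a general rotation system is a pure rotation system together with a map $\tau:E(G)\to\{0,1\}$ (an edge $e$ is twisted if $\tau(e)=1$, untwisted otherwise); it determines a cellular embedding of $G$ in a closed surface. For a fixed spanning tree $T$ of $G$, a $T$-rotation system is a general rotation system with $\tau(e)=0$ for all $e\in E(T)$. Embeddings with equivalent $T$-rotation systems are identified, so the number $\varepsilon_G(i)$ of equivalent embeddings of $G$ into surfaces of Euler-genus $i$ is the number of $T$-rotation systems whose embedding surface has Euler-genus $i$. The graphs $H_{m_1,\dots,m_k}$. Let $k\ge 2$, $m_1,\dots,m_k\ge 1$. Put $n_1=m_1$, $n_i=m_i+1$ for $1<i<k$, $n_k=m_k$, and $\ell=n_1+\dots+n_k$. Take the path $v_0v_1\cdots v_{\ell+1}$ drawn horizontally and attach to each $v_i$ ($1\le i\le\ell$) a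 leaf $u_i$; the first $n_1$ of the leaves $u_i$ are drawn above the path, the next $n_2$ below, the next $n_3$ above, and so on alternately. Add a cycle $C$ through all leaves of this tree in their planar order: $v_0$, then the upper leaves $u_i$ in increasing order of index, then $v_{\ell+1}$, then the lower leaves $u_i$ in decreasing order of index. The resulting cubic graph is the cubic caterpillar-Halin graph $H_{m_1,\dots,m_k}$. Write $\varepsilon_{m_1,\dots,m_k}(j)=\varepsilon_{H_{m_1,\dots,m_k}}(j)$. *)

(* Defs.v *)
From HB Require Import structures.
From mathcomp Require Import all_boot all_order all_algebra all_fingroup.

Set Implicit Arguments.
Unset Strict Implicit.
Unset Printing Implicit Defensive.

Record sgraph := SGraph {
  vertex :> finType;
  adj : rel vertex;
  adj_sym : symmetric adj;
  adj_irr : irreflexive adj }.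

Definition edge_set (G : sgraph) : {set {set G}} :=
  [set [set p.1; p.2] | p : G * G & adj p.1 p.2].

Definition edge (G : sgraph) : finType := {f : {set G} | f \in edge_set G}.

(* A dart (v, w) is the edge vw seen as incident with its end v. *)
Definition dart (G : sgraph) : finType := {p : G * G | adj p.1 p.2}.

Definition dtail (G : sgraph) (d : dart G) : G := (val d).1.

Lemma dart_revP (G : sgraph) (d : dart G) : adj (val d).2 (val d).1.
Proof. by rewrite adj_sym; exact: (valP d). Qed.

Definition drev (G : sgraph) (d : dart G) : dart G :=
  exist _ ((val d).2, (val d).1) (dart_revP d).

Lemma dart_edgeP (G : sgraph) (d : dart G) :
  [set (val d).1; (val d).2] \in edge_set G.
Proof. by apply/imsetP; exists (val d) => //; rewrite inE; exact: (valP d). Qed.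

Definition dedge (G : sgraph) (d : dart G) : edge G :=
  exist _ [set (val d).1; (val d).2] (dart_edgeP d).

Definition sub_adj (G : sgraph) (T : {set edge G}) : rel G :=
  fun x y => [set x; y] \in [set val f | f in T].

Definition spanning_tree (G : sgraph) (T : {set edge G}) : Prop :=
  (forall x y : G, connect (sub_adj T) x y) /\
  (forall c : seq G, 2 < size c -> ~ ucycle (sub_adj T) c).

(* The cyclic permutations of the edges at all the vertices are bundled into
   one permutation of the darts, whose cycles are the dart sets of the
   vertices. *)
Definition pure_rotation (G : sgraph) (r : {perm dart G}) : bool :=
  [forall d, porbit r d == [set d' | dtail d' == dtail d]].

(* Underlying data of a general rotation system; the second component is the
   map tau, true on the twisted edges. *)
Definition rotation_data (G : sgraph) : finType :=
  ({perm dart G} * {ffun edge G -> bool})%type.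

Definition T_rotation_system (G : sgraph) (T : {set edge G})
    (rho : rotation_data G) : bool :=
  pure_rotation rho.1 && [forall f in T, ~~ rho.2 f].

(* The flag (d, s) is the side of the edge d near its end v = dtail d: the side
   facing the rotation successor of d at v if s, its predecessor otherwise. *)
Definition flag (G : sgraph) : finType := (dart G * bool)%type.

(* Two flags in the same corner at a vertex. *)
Definition across_corner (G : sgraph) (rho : rotation_data G) (x : flag G) :
    flag G :=
  if x.2 then (rho.1 x.1, false) else ((rho.1^-1)%g x.1, true).

(* Two ends of the same side of an edge. Along an untwisted edge the local
   orientations of the ends agree, so that the successor side at one end is
   the predecessor side at the other. *)
Definition along_edge (G : sgraph) (rho : rotation_data G) (x : flag G) :
    flag G :=
  (drev x.1, if rho.2 (dedge x.1) then x.2 else ~~ x.2).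

Definition same_face (G : sgraph) (rho : rotation_data G) : rel (flag G) :=
  fun x y => (y == across_corner rho x) || (y == along_edge rho x).

Definition nfaces (G : sgraph) (rho : rotation_data G) : nat :=
  n_comp (same_face rho) predT.

Local Open Scope ring_scope.

(* Euler characteristic of the surface of a cellular embedding of a connected
   graph with at least one edge. *)
Definition euler_char (G : sgraph) (rho : rotation_data G) : int :=
  #|G|%:Z - #|edge G|%:Z + (nfaces rho)%:Z.

(* The local orientations at the vertices can be chosen so as to agree along
   every edge: b marks the vertices where the given one is reversed. *)
Definition orientable (G : sgraph) (rho : rotation_data G) : bool :=
  [exists b : {ffun G -> bool}, [forall d : dart G,
     rho.2 (dedge d) == b (val d).1 (+) b (val d).2]].

(* Closed surfaces, by the number of handles and the number (at least 1) of
   crosscaps respectively. *)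
Inductive surface := Orientable of nat | NonOrientable of nat.

Definition euler_genus (S : surface) : nat :=
  match S with Orientable j => (2 * j)%N | NonOrientable c => c end.

Definition surface_char (S : surface) : int :=
  match S with Orientable j => 2 - 2 * j%:Z | NonOrientable c => 2 - c%:Z end.

Definition surface_orientable (S : surface) : bool :=
  if S is Orientable _ then true else false.

(* By the classification of closed surfaces, orientability and Euler
   characteristic identify the surface of the embedding. *)
Definition embeds_in (G : sgraph) (rho : rotation_data G) (S : surface) : bool :=
  (orientable rho == surface_orientable S) && (euler_char rho == surface_char S).

(* j and c are at most the Euler-genus, so the candidates are exhaustive. *)
Definition surfaces_of_genus (i : nat) : seq surface :=
  [seq S <- [seq Orientable j | j <- iota 0 i.+1]
            ++ [seq NonOrientable c | c <- iota 1 i] | euler_genus S == i].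

Definition num_embeddings (G : sgraph) (T : {set edge G}) (i : nat) : nat :=
  #|[set rho : rotation_data G |
      T_rotation_system T rho & has (embeds_in rho) (surfaces_of_genus i)]|.

Local Close Scope ring_scope.

(* The sequence m_1, ..., m_k is given by the values at 1, ..., k of a function
   m : nat -> nat. *)
Definition block_size (k : nat) (m : nat -> nat) (i : nat) : nat :=
  if (i == 1) || (i == k) then m i else (m i).+1.

Definition spine_len (k : nat) (m : nat -> nat) : nat :=
  \sum_(1 <= i < k.+1) block_size k m i.

(* The entry of index i - 1 tells whether the leaf u_i is drawn above the path;
   the odd-numbered blocks are. *)
Definition leaf_sides (k : nat) (m : nat -> nat) : seq bool :=
  flatten [seq nseq (block_size k m b) (odd b) | b <- iota 1 k].

Section CaterpillarHalin.

Variables (k : nat) (m : nat -> nat).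

Local Notation l := (spine_len k m).

(* [inl i] is v_i for 0 <= i <= l + 1, and [inr i] is u_(i+1) for
   0 <= i < l. *)
Definition halin_vertex : finType := ('I_l.+2 + 'I_l)%type.

Definition upper_leaves : seq halin_vertex :=
  [seq inr i | i : 'I_l <- enum 'I_l & nth false (leaf_sides k m) i].

Definition lower_leaves : seq halin_vertex :=
  [seq inr i | i : 'I_l <- enum 'I_l & ~~ nth false (leaf_sides k m) i].

Definition halin_cycle : seq halin_vertex :=
  inl ord0 :: upper_leaves ++ inl ord_max :: rev lower_leaves.

Definition tree_arc (x y : halin_vertex) : bool :=
  match x, y with
  | inl i, inl j => val j == (val i).+1
  | inl i, inr j => val i == (val j).+1
  | _, _ => false
  end.

Definition cycle_arc (x y : halin_vertex) : bool :=
  (x \in halin_cycle) && (y == next halin_cycle x).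

Definition halin_adj (x y : halin_vertex) : bool :=
  (x != y) && [|| tree_arc x y, tree_arc y x, cycle_arc x y | cycle_arc y x].

Lemma halin_adj_sym : symmetric halin_adj.
Proof.
by move=> x y; rewrite /halin_adj eq_sym; congr andb; rewrite !orbA;
   rewrite [tree_arc x y || _]orbC -!orbA [cycle_arc x y || _]orbC.
Qed.

Lemma halin_adj_irr : irreflexive halin_adj.
Proof. by move=> x; rewrite /halin_adj eqxx. Qed.

Definition caterpillar_halin : sgraph := SGraph halin_adj_sym halin_adj_irr.

End CaterpillarHalin.

(* Main.v *)
Require Import Defs.
From HB Require Import structures.
From mathcomp Require Import all_boot all_order all_algebra all_fingroup.
From mathcomp Require Import ring zify.

(** Reversing the local orientation at a vertex of a cubic graph exchanges its two
    rotations and toggles the twists of the incident edges. Hence the number of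
    T-rotation systems with a given number of faces is twice the number of twist
    functions [t] having that number of faces together with one fixed rotation.

    For every number [z] of colours, [z ^ F] is the number of colourings of the
    corners that are constant along each of the [F] faces, so [\sum_t z ^ F(t)] is
    a state sum: the corners are coloured arbitrarily, and an edge contributes the
    sum over its two ways of joining the two corners at one end to the two corners
    at the other. Reading the caterpillar from left to right, the part already
    read is joined to the rest by three edges (upper cycle, spine, lower cycle).
    Its state sum is a combination of the five functions [tr(ABC)], [tr A tr(BC)],
    [tr B tr(AC)], [tr C tr(AB)], [tr A tr B tr C] of these three strands, and
    reading a further leaf acts on the coefficients by a 5 x 5 matrix of
    polynomials in [z]. Euler-genus 2 means [F = l + 1], which is two below the
    maximal degree [l + 3], so only the few leading coefficients matter; they obey
    a linear recursion that is solved block by block. *)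

Set Implicit Arguments.
Unset Strict Implicit.
Unset Printing Implicit Defensive.

Import GRing.Theory.

(** * Colour tensors on three strands *)

Section Tensors.

Local Open Scope ring_scope.

Variable C : finType.
Implicit Types (a b c x y : C) (p q : C * C).

Definition delta a b : int := (a == b)%:R.

(** With pairs that list the successor side first, the first summand joins the ends of a twisted
    edge and the second those of an untwisted one. *)
Definition edge_weight p q : int :=
  delta p.1 q.1 * delta p.2 q.2 + delta p.1 q.2 * delta p.2 q.1.

Definition loop_weight p : int := delta p.1 p.2.

Lemma deltaC a b : delta a b = delta b a.
Proof. by rewrite /delta eq_sym. Qed.

Lemma deltaxx a : delta a a = 1.
Proof. by rewrite /delta eqxx. Qed.

Lemma edge_weightC p q : edge_weight p q = edge_weight q p.
Proof.
rewrite /edge_weight (deltaC p.1) (deltaC p.2) (deltaC p.1 q.2) (deltaC p.2 q.1).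
by congr (_ + _); rewrite mulrC.
Qed.

Lemma sum_delta a (F : C -> int) : \sum_x delta a x * F x = F a.
Proof.
rewrite (bigD1 a) //= deltaxx mul1r big1 ?addr0 // => x /negbTE nax.
by rewrite /delta eq_sym nax mul0r.
Qed.

Lemma sum_delta1 a : \sum_x delta a x = 1.
Proof. by rewrite -[RHS](sum_delta a (fun=> 1)); apply: eq_bigr => x; rewrite mulr1. Qed.

Lemma sum_edge_weight p (F : C -> C -> int) :
  \sum_x \sum_y F x y * edge_weight p (x, y) = F p.1 p.2 + F p.2 p.1.
Proof.
pose G a b x y := delta a x * (delta b y * F x y).
transitivity (\sum_x \sum_y G p.1 p.2 x y + \sum_x \sum_y G p.2 p.1 x y).
  rewrite -big_split; apply: eq_bigr => x _; rewrite -big_split; apply: eq_bigr => y _.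
  by rewrite /edge_weight /G /=; ring.
by congr (_ + _); rewrite -[RHS](sum_delta _ (F^~ _)); apply: eq_bigr => x _;
   rewrite -mulr_sumr sum_delta.
Qed.

Implicit Types (P : C * C -> C * C -> int) (X Y Z A B : C * C).

(* A rung (v2 v1) -- (u2 u1) is inserted between two strands; slots 0, 1 and 2
   of the corner triples u and v are the ones of the new vertices. *)
Definition add_rung P A B : int :=
  \sum_u0 \sum_u1 \sum_v0 \sum_v1 \sum_u2 \sum_v2
    P (u0, u2) (v0, v2) * edge_weight (v2, v1) (u2, u1)
      * edge_weight A (u1, u0) * edge_weight B (v1, v0).

(** What the sum over [u2] and [v2] leaves. One joining of the rung identifies [u1] with [v1] and
    [u2] with [v2], the free colour [x]; the other identifies [u2] with [v1] and [v2] with [u1]. *)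
Definition rung_kernel P u0 u1 v0 v1 : int :=
  delta u1 v1 * (\sum_x P (u0, x) (v0, x)) + P (u0, v1) (v0, u1).

Lemma add_rungE P A B :
  add_rung P A B =
    rung_kernel P A.2 A.1 B.2 B.1 + rung_kernel P A.2 A.1 B.1 B.2
    + rung_kernel P A.1 A.2 B.2 B.1 + rung_kernel P A.1 A.2 B.1 B.2.
Proof.
have inner u0 u1 v0 v1 :
    \sum_u2 \sum_v2 P (u0, u2) (v0, v2) * edge_weight (v2, v1) (u2, u1)
      * edge_weight A (u1, u0) * edge_weight B (v1, v0)
    = rung_kernel P u0 u1 v0 v1 * edge_weight A (u1, u0) * edge_weight B (v1, v0).
  under eq_bigr => u2 _ do rewrite -2!mulr_suml.
  rewrite -2!mulr_suml; congr (_ * _ * _).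
  rewrite /rung_kernel mulr_sumr -[P _ (_, u1)](sum_delta v1 (fun x => P (u0, x) (v0, u1))).
  rewrite -big_split; apply: eq_bigr => u2 _ /=.
  rewrite -(sum_delta u2 (fun y => P (u0, u2) (v0, y))).
  rewrite -(sum_delta u1 (fun y => P (u0, u2) (v0, y))).
  rewrite !mulr_sumr -big_split; apply: eq_bigr => v2 _ /=.
  by rewrite /edge_weight /= (deltaC v2 u2) (deltaC v2 u1) (deltaC v1 u1); ring.
rewrite /add_rung.
under eq_bigr => u0 _ do under eq_bigr => u1 _ do under eq_bigr => v0 _ do
  under eq_bigr => v1 _ do rewrite inner.
pose H u0 u1 := rung_kernel P u0 u1 B.2 B.1 + rung_kernel P u0 u1 B.1 B.2.
rewrite exchange_big /=.
under eq_bigr => u1 _.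
  under eq_bigr => u0 _.
    rewrite exchange_big /=.
    under eq_bigr => v1 _ do under eq_bigr => v0 _ do
      rewrite (mulrC (rung_kernel _ _ _ _ _)) -mulrA.
    under eq_bigr => v1 _ do rewrite -mulr_sumr.
    rewrite -mulr_sumr (sum_edge_weight B (fun v1 v0 => rung_kernel P u0 u1 v0 v1)).
    rewrite mulrC.
  over.
over.
rewrite (sum_edge_weight A (fun u1 u0 => rung_kernel P u0 u1 B.2 B.1 + rung_kernel P u0 u1 B.1 B.2)).
by rewrite !addrA.
Qed.

(* The symmetrised tr(XYZ). *)
Definition triangle_weight X Y Z : int :=
  delta X.1 Y.1 * edge_weight (X.2, Y.2) Z + delta X.1 Y.2 * edge_weight (X.2, Y.1) Z
  + delta X.2 Y.1 * edge_weight (X.1, Y.2) Z + delta X.2 Y.2 * edge_weight (X.1, Y.1) Z.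

Lemma triangle_weight_rev X Y Z : triangle_weight X Y Z = triangle_weight Z Y X.
Proof.
rewrite /triangle_weight /edge_weight /=.
rewrite !(deltaC Z.1) !(deltaC Z.2) !(deltaC Y.1 X.1) !(deltaC Y.1 X.2)
  !(deltaC Y.2 X.1) !(deltaC Y.2 X.2).
ring.
Qed.

(** The corners [x], [y], [w] of a single cubic vertex separate its three strands, so summing them
    out gives a trace. This is the starting vertex v_0. *)
Lemma triangle_weight_vertex X Y Z :
  \sum_x \sum_y \sum_w edge_weight X (x, y) * edge_weight Y (y, w) * edge_weight Z (w, x)
  = triangle_weight X Y Z.
Proof.
pose F x y := delta Y.1 y * edge_weight Z (Y.2, x) + delta Y.2 y * edge_weight Z (Y.1, x).
transitivity (\sum_x \sum_y F x y * edge_weight X (x, y)).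
  apply: eq_bigr => x _; apply: eq_bigr => y _.
  under eq_bigr => w _ do rewrite -mulrA.
  rewrite -mulr_sumr mulrC; congr (_ * _).
  rewrite /F -[edge_weight Z (Y.2, x)](sum_delta _ (fun w => edge_weight Z (w, x))).
  rewrite -[edge_weight Z (Y.1, x)](sum_delta _ (fun w => edge_weight Z (w, x))).
  rewrite !mulr_sumr -big_split; apply: eq_bigr => w _ /=.
  by rewrite /edge_weight /=; ring.
rewrite sum_edge_weight /F /triangle_weight /edge_weight /=.
rewrite !(deltaC Z.1) !(deltaC Z.2) !(deltaC Y.1 X.1) !(deltaC Y.1 X.2)
  !(deltaC Y.2 X.1) !(deltaC Y.2 X.2).
ring.
Qed.

Local Notation z := (#|C|%:R : int).

Lemma sum_diag_edge_weight Z : \sum_x edge_weight (x, x) Z = 2 * loop_weight Z.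
Proof.
have -> : 2 * loop_weight Z = \sum_x delta Z.1 x * (2 * delta x Z.2).
  by rewrite sum_delta.
by apply: eq_bigr => x _; rewrite /edge_weight /= (deltaC Z.1); ring.
Qed.

(** With the four lemmas that follow, this gives the columns of the transfer matrix. The [z] here
    comes from the term in which the free colour of the kernel is compared only with itself. *)
Lemma add_rung_triangle A B Z :
  add_rung (fun X Y => triangle_weight X Y Z) A B =
    (z + 4) * triangle_weight A B Z + 4 * (loop_weight A * edge_weight B Z)
    + 4 * (loop_weight B * edge_weight A Z) + 4 * (loop_weight Z * edge_weight A B).
Proof.
have K u0 u1 v0 v1 : rung_kernel (fun X Y => triangle_weight X Y Z) u0 u1 v0 v1
  = delta u1 v1 * ((z + 2) * edge_weight (u0, v0) Z + 2 * delta u0 v0 * loop_weight Z)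
    + (delta u0 v0 * edge_weight (v1, u1) Z + delta u0 u1 * edge_weight (v1, v0) Z
       + delta v1 v0 * edge_weight (u0, u1) Z + delta v1 u1 * edge_weight (u0, v0) Z).
  rewrite /rung_kernel; congr (_ * _ + _).
  rewrite /triangle_weight /= !big_split /= -!mulr_sumr sum_diag_edge_weight.
  rewrite (sum_delta u0 (fun x => edge_weight (x, v0) Z)).
  under [X in _ + _ + X + _]eq_bigr => x _ do rewrite deltaC.
  rewrite (sum_delta v0 (fun x => edge_weight (u0, x) Z)).
  under [X in _ + _ + _ + X]eq_bigr => x _ do rewrite deltaxx mul1r.
  by rewrite sumr_const -mulr_natl; ring.
rewrite add_rungE !K /triangle_weight /loop_weight /edge_weight /=.
rewrite !(deltaC B.1 A.1) !(deltaC B.1 A.2) !(deltaC B.2 A.1) !(deltaC B.2 A.2)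
  !(deltaC A.2 A.1) !(deltaC B.2 B.1).
ring.
Qed.

Lemma add_rung_loop1 A B Z :
  add_rung (fun X Y => loop_weight X * edge_weight Y Z) A B = 2 * triangle_weight A B Z.
Proof.
have K u0 u1 v0 v1 : rung_kernel (fun X Y => loop_weight X * edge_weight Y Z) u0 u1 v0 v1
  = delta u1 v1 * edge_weight (v0, u0) Z + delta u0 v1 * edge_weight (v0, u1) Z.
  rewrite /rung_kernel; congr (_ * _ + _).
  exact: (sum_delta u0 (fun x => edge_weight (v0, x) Z)).
rewrite add_rungE !K /triangle_weight /loop_weight /edge_weight /=.
ring.
Qed.

Lemma add_rung_loop2 A B Z :
  add_rung (fun X Y => loop_weight Y * edge_weight X Z) A B = 2 * triangle_weight A B Z.
Proof.
have K u0 u1 v0 v1 : rung_kernel (fun X Y => loop_weight Y * edge_weight X Z) u0 u1 v0 v1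
  = delta u1 v1 * edge_weight (u0, v0) Z + delta v0 u1 * edge_weight (u0, v1) Z.
  rewrite /rung_kernel; congr (_ * _ + _).
  exact: (sum_delta v0 (fun x => edge_weight (u0, x) Z)).
rewrite add_rungE !K /triangle_weight /loop_weight /edge_weight /=.
rewrite !(deltaC B.1 A.1) !(deltaC B.1 A.2) !(deltaC B.2 A.1) !(deltaC B.2 A.2).
ring.
Qed.

(** The scalar [c] stands for the loop on the third strand, which the rung does not touch. *)
Lemma add_rung_loop3 (c : int) A B :
  add_rung (fun X Y => c * edge_weight X Y) A B =
    (2 * z + 4) * (c * edge_weight A B) + 4 * (loop_weight A * loop_weight B * c).
Proof.
have K u0 u1 v0 v1 : rung_kernel (fun X Y => c * edge_weight X Y) u0 u1 v0 v1
  = c * (delta u1 v1 * ((z + 1) * delta u0 v0)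
    + (delta u0 v0 * delta v1 u1 + delta u0 u1 * delta v1 v0)).
  rewrite /rung_kernel -mulr_sumr /edge_weight /= big_split /=.
  under eq_bigr => x _ do rewrite deltaxx mulr1.
  under [X in _ * (_ * (_ + X))]eq_bigr => x _ do rewrite (deltaC x v0).
  rewrite sumr_const -mulr_natl.
  under [X in _ * (_ * (_ + X))]eq_bigr => x _ do rewrite mulrC.
  rewrite (sum_delta v0 (fun x => delta u0 x)).
  ring.
rewrite add_rungE !K /loop_weight /edge_weight /=.
rewrite !(deltaC B.1 A.1) !(deltaC B.1 A.2) !(deltaC B.2 A.1) !(deltaC B.2 A.2)
  !(deltaC A.2 A.1) !(deltaC B.2 B.1).
ring.
Qed.

Lemma add_rung_loop4 (c : int) A B :
  add_rung (fun X Y => loop_weight X * loop_weight Y * c) A B = 4 * (c * edge_weight A B).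
Proof.
have K u0 u1 v0 v1 : rung_kernel (fun X Y => loop_weight X * loop_weight Y * c) u0 u1 v0 v1
  = c * (delta u1 v1 * delta u0 v0 + delta u0 v1 * delta v0 u1).
  rewrite /rung_kernel -mulr_suml /loop_weight /=.
  rewrite (sum_delta u0 (fun x => delta v0 x)) (deltaC v0 u0).
  ring.
rewrite add_rungE !K /loop_weight /edge_weight /=.
rewrite !(deltaC B.1 A.1) !(deltaC B.1 A.2) !(deltaC B.2 A.1) !(deltaC B.2 A.2).
ring.
Qed.

(** The three strands end at a common last vertex with corners [x], [y], [w]. *)
Definition close_up (Q : C * C -> C * C -> C * C -> int) : int :=
  \sum_(x : C) \sum_(y : C) \sum_(w : C) Q (x, y) (y, w) (w, x).

Lemma delta_idem a b : delta a b * delta a b = delta a b.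
Proof. by rewrite /delta; case: (a == b); rewrite ?mulr1 ?mulr0. Qed.

(** State sum of two vertices joined by three edges: of the eight joinings one gives three faces,
    three give two and four give one. *)
Lemma close_up_triangle : close_up triangle_weight = z ^+ 3 + 3 * z ^+ 2 + 4 * z.
Proof.
have inner x y : \sum_w triangle_weight (x, y) (y, w) (w, x) = (z + 4) * delta x y + (z + 2).
  have -> : \sum_w triangle_weight (x, y) (y, w) (w, x)
    = \sum_w (delta x w * delta x w + 1 + delta y w * delta y w
              + delta x w * (2 * (delta y w * delta x y))
              + delta y w * (delta x w * delta x y)
              + delta x y * delta x y + delta y w * (delta x w * delta x y)).
    apply: eq_bigr => w _; rewrite /triangle_weight /edge_weight /= !deltaxx.
    rewrite !(deltaC w) !(deltaC y x); ring.
  rewrite !big_split /= (sum_delta x (delta x)) (sum_delta y (delta y)).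
  rewrite (sum_delta x (fun w => 2 * (delta y w * delta x y))).
  rewrite (sum_delta y (fun w => delta x w * delta x y)) !sumr_const -(mulr_natl (_ * _)).
  rewrite !deltaxx (deltaC y x) !delta_idem; ring.
rewrite /close_up; under eq_bigr => x _ do under eq_bigr => y _ do rewrite inner.
under eq_bigr => x _ do rewrite big_split -mulr_sumr sum_delta1 sumr_const -mulr_natl /=.
by rewrite sumr_const -mulr_natl; ring.
Qed.

Lemma close_up_loop1 :
  close_up (fun X Y Z => loop_weight X * edge_weight Y Z) = z ^+ 2 + z.
Proof.
have inner x y : \sum_w loop_weight (x, y) * edge_weight (y, w) (w, x)
    = (z + 1) * delta x y.
  have -> : \sum_w loop_weight (x, y) * edge_weight (y, w) (w, x)
      = \sum_w (delta y w * (delta x w * delta x y) + delta x y * delta x y).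
    apply: eq_bigr => w _; rewrite /loop_weight /edge_weight /= !deltaxx.
    rewrite !(deltaC w) !(deltaC y x); ring.
  by rewrite big_split /= (sum_delta y (fun w => delta x w * delta x y)) sumr_const -mulr_natl !delta_idem; ring.
rewrite /close_up; under eq_bigr => x _ do under eq_bigr => y _ do rewrite inner.
under eq_bigr => x _ do rewrite -mulr_sumr sum_delta1 mulr1.
by rewrite sumr_const -mulr_natl; ring.
Qed.

Lemma close_up_rotate Q : close_up (fun X Y Z => Q Y Z X) = close_up Q.
Proof.
rewrite /close_up exchange_big /=; apply: eq_bigr => y _.
by rewrite exchange_big.
Qed.

Lemma close_up_loop2 :
  close_up (fun X Y Z => loop_weight Y * edge_weight X Z) = z ^+ 2 + z.
Proof.
rewrite -close_up_loop1 -(close_up_rotate (fun X Y Z => loop_weight X * _)).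
rewrite /close_up; apply: eq_bigr => x _; apply: eq_bigr => y _.
by apply: eq_bigr => w _; rewrite edge_weightC.
Qed.

Lemma close_up_loop3 :
  close_up (fun X Y Z => loop_weight Z * edge_weight X Y) = z ^+ 2 + z.
Proof.
rewrite -close_up_loop1.
by rewrite -(close_up_rotate (fun X Y Z => loop_weight Z * _)).
Qed.

Lemma close_up_loop4 :
  close_up (fun X Y Z => loop_weight X * loop_weight Y * loop_weight Z) = z.
Proof.
rewrite /close_up /loop_weight /=.
have inner x y : \sum_w delta x y * delta y w * delta w x = delta x y.
  under eq_bigr => w _ do rewrite mulrAC mulrC.
  by rewrite (sum_delta y (fun w => delta x y * delta w x)) deltaC delta_idem.
under eq_bigr => x _ do (under eq_bigr => y _ do rewrite inner); rewrite ?sum_delta1.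
under eq_bigr => x _ do rewrite sum_delta1.
by rewrite sumr_const.
Qed.

End Tensors.

(** * Rotation systems of cubic graphs *)

Definition invariant_colouring (T : finType) (e : rel T) (z : nat)
    (f : {ffun T -> 'I_z}) : bool :=
  [forall x, forall y, e x y ==> (f x == f y)].

Lemma invariant_connect (T : finType) (e : rel T) (z : nat)
    (f : {ffun T -> 'I_z}) :
  invariant_colouring e f -> forall x y, connect e x y -> f x = f y.
Proof.
move=> inv x y /connectP[p pth ->]; elim: p x pth => //= a p IHp x /andP[exa pth].
rewrite -(IHp a pth); apply/eqP.
by move: inv => /forallP/(_ x)/forallP/(_ a)/implyP/(_ exa).
Qed.

(** An invariant colouring amounts to an arbitrary colouring of the roots of the components. *)
Lemma card_invariant_colouring (T : finType) (e : rel T) (z : nat) :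
  connect_sym e ->
  #|[set f : {ffun T -> 'I_z} | invariant_colouring e f]| = z ^ n_comp e predT.
Proof.
move=> sym_e; pose R := {x : T | x \in roots e}.
have rootP x : fingraph.root e x \in roots e by exact: roots_root.
pose r x : R := Sub (fingraph.root e x) (rootP x).
pose F (g : {ffun R -> 'I_z}) : {ffun T -> 'I_z} := [ffun x => g (r x)].
have rK (y : R) : r (val y) = y by apply: val_inj; apply/eqP; exact: (valP y).
have F_inj : injective F.
  by move=> g1 g2 /ffunP eqg; apply/ffunP=> y; move: (eqg (val y)); rewrite !ffunE rK.
rewrite [RHS](_ : _ = #|[set F g | g : {ffun R -> 'I_z}]|); last first.
  rewrite card_imset // card_ffun card_ord card_sig; congr (_ ^ _).
  by apply: eq_card => x; rewrite !inE andbT.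
apply: eq_card => f; rewrite !inE; apply/idP/imsetP => [inv | [g _ ->]].
  exists [ffun y => f (val y)] => //; apply/ffunP=> x; rewrite !ffunE /=.
  by apply: (invariant_connect inv); exact: connect_root.
apply/forallP=> x; apply/forallP=> y; apply/implyP=> exy; rewrite !ffunE.
by apply/eqP; congr (g _); apply: val_inj; apply/eqP; rewrite /= root_connect // connect1.
Qed.

(** A nonzero difference has finitely many roots. The arguments are positive so that ['I_z.+1]
    offers [ord0] as a default colour. *)
Lemma poly_eq_natr (p q : {poly int}) :
  (forall z : nat, p.[z.+1%:R] = q.[z.+1%:R])%R -> p = q.
Proof.
move=> eqpq; apply/eqP; rewrite -subr_eq0; apply/negPn/negP=> nz.
pose s : seq int := [seq i.+1%:R%R | i <- iota 0 (size (p - q)%R)].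
have := @max_poly_roots _ (p - q)%R s nz.
rewrite size_map size_iota ltnn => H; have : false; last by [].
apply: H.
  by apply/allP=> _ /mapP[i _ ->]; rewrite /root !hornerE eqpq subrr.
by rewrite map_inj_uniq ?iota_uniq // => i j; rewrite !natz => -[].
Qed.

(** * Flags, faces and their invariant colourings *)

Section Faces.

Variable G : sgraph.
Implicit Types (d : dart G) (x : flag G) (rho : rotation_data G).

Lemma drevK : involutive (@drev G).
Proof. by case=> -[u v] uv; apply: val_inj. Qed.

Lemma dedge_drev d : dedge (drev d) = dedge d.
Proof. by apply: val_inj; rewrite /= setUC. Qed.

Lemma dart_neq d : (val d).1 != (val d).2.
Proof. by apply: contraTN (valP d) => /eqP ->; rewrite adj_irr. Qed.

Lemma dedge_eq d d' : dedge d = dedge d' -> d' = d \/ d' = drev d.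
Proof.
move=> /(congr1 val)/= /setP E; have nd := dart_neq d; have nd' := dart_neq d'.
case: d d' nd nd' E => [[u v] uv] [[u' v'] uv'] /= nd nd' E.
move: (E u) (E v) (E u') (E v'); rewrite !inE !eqxx /= ?orbT.
move=> /esym/orP[]/eqP eu /esym/orP[]/eqP ev _ _; subst.
- by rewrite eqxx in nd.
- by left; apply: val_inj.
- by right; apply: val_inj.
- by rewrite eqxx in nd.
Qed.

Lemma dedge_surj (f : edge G) : exists d, dedge d = f.
Proof.
case: f => f fE; case/imsetP: (fE) => -[u v]; rewrite inE /= => uv Ef.
by exists (exist _ (u, v) uv); apply: val_inj.
Qed.

Lemma across_cornerK rho : involutive (across_corner rho).
Proof. by case=> d [] /=; rewrite /across_corner /= ?permK ?permKV. Qed.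

Lemma along_edgeK rho : involutive (along_edge rho).
Proof.
case=> d s; rewrite /along_edge /= drevK dedge_drev.
by case: (rho.2 _); rewrite ?negbK.
Qed.

Lemma same_face_sym rho : connect_sym (same_face rho).
Proof.
apply: sym_connect_sym => x y; rewrite /same_face.
by rewrite ![y == _]eq_sym (can2_eq (across_cornerK rho) (across_cornerK rho))
   (can2_eq (along_edgeK rho) (along_edgeK rho)).
Qed.

Lemma same_face_colouringP rho z (f : {ffun flag G -> 'I_z}) :
  reflect (forall x, f (across_corner rho x) = f x /\ f (along_edge rho x) = f x)
    (invariant_colouring (same_face rho) f).
Proof.
apply: (iffP idP) => [inv x|inv].
  by split; apply/esym/(invariant_connect inv)/connect1; rewrite /same_face eqxx ?orbT.
apply/forallP=> x; apply/forallP=> y; apply/implyP => /orP[]/eqP->;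
by have [e1 e2] := inv x; rewrite ?e1 ?e2.
Qed.

(** The number of faces is read off from the number of invariant 2-colourings, which precomposition
    with [h] preserves. *)
Lemma nfaces_conj rho rho' (h : flag G -> flag G) : involutive h ->
  (forall x, h (across_corner rho x) = across_corner rho' (h x)) ->
  (forall x, h (along_edge rho x) = along_edge rho' (h x)) ->
  nfaces rho = nfaces rho'.
Proof.
move=> hK h1 h2; suff: 2 ^ nfaces rho = 2 ^ nfaces rho' by move/(@expnI 2 isT).
apply: etrans (esym (card_invariant_colouring 2 (same_face_sym rho))) _.
apply: etrans _ (card_invariant_colouring 2 (same_face_sym rho')).
pose F (f : {ffun flag G -> 'I_2}) : {ffun flag G -> 'I_2} := [ffun x => f (h x)].
have FK : involutive F by move=> f; apply/ffunP=> x; rewrite !ffunE hK.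
rewrite -(card_imset _ (inv_inj FK)); apply: eq_card => f.
rewrite -[f in LHS]FK mem_imset; last exact: inv_inj.
rewrite !inE; apply/same_face_colouringP/same_face_colouringP => H x.
  by have := H (h x); rewrite !ffunE h1 h2 hK.
by rewrite !ffunE h1 h2; exact: H.
Qed.

End Faces.

(** * Twists as coboundaries of vertex reversals *)

Section Potential.

Variable G : sgraph.
Implicit Types (b : {ffun G -> bool}) (T : {set edge G}).

(** The change of the twists when the local orientations marked by [b] are reversed: an edge is
    toggled once for each reversed end. *)
Definition coboundary b (f : edge G) : bool := \big[addb/false]_(v in val f) b v.

Lemma coboundary_dart b (d : dart G) :
  coboundary b (dedge d) = b (val d).1 (+) b (val d).2.
Proof.
rewrite /coboundary /= big_setU1 ?big_set1 // inE; exact: dart_neq.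
Qed.

Lemma sub_adjP T (u v : G) :
  reflect (exists2 d : dart G, dedge d \in T & val d = (u, v)) (sub_adj T u v).
Proof.
apply: (iffP imsetP) => [[f fT Ef] | [d dT Ed]]; last first.
  by exists (dedge d) => //=; rewrite Ed.
have [d Ed] := dedge_surj f; move: Ef; rewrite -Ed /= => E.
have nd := dart_neq d.
have : [set u; v] = [set (val d).1; (val d).2] by [].
move/setP=> H; move: (H u) (H v) (H (val d).1) (H (val d).2).
rewrite !inE !eqxx /= ?orbT => /esym/orP[]/eqP eu /esym/orP[]/eqP ev.
- by rewrite eu ev !orbb => _ /eqP H2; rewrite -H2 eqxx in nd.
- by exists d; [rewrite Ed | rewrite eu ev -surjective_pairing].
- by exists (drev d); [rewrite dedge_drev Ed | rewrite /= eu ev].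
- by rewrite eu ev !orbb => /eqP H2; rewrite -H2 eqxx in nd.
Qed.

Lemma sub_adj_sym T : symmetric (sub_adj T).
Proof. by move=> u v; rewrite /sub_adj setUC. Qed.

Lemma coboundary_inj T b b' : (forall u v, connect (sub_adj T) u v) ->
  {in T, coboundary b =1 coboundary b'} -> forall u, b u = b' u -> b = b'.
Proof.
move=> conT eqb u eu; apply/ffunP=> v.
have /connectP[p pth ->] := conT u v; elim: p u eu pth => //= w p IHp u eu.
case/andP=> /sub_adjP[d dT Ed] pth; apply: IHp pth.
by have := eqb _ dT; rewrite !coboundary_dart Ed /= eu; move/addbI.
Qed.

Definition acyclic T : Prop := forall c : seq G, 2 < size c -> ~ ucycle (sub_adj T) c.

(** Induction on the number of edges: removing [f] separates its ends, so a potential for the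
    remaining edges can be flipped on one side to become right at [f] as well. *)
Lemma acyclic_potential T (t : {ffun edge G -> bool}) :
  acyclic T -> exists b, {in T, coboundary b =1 t}.
Proof.
have [n] := ubnP #|T|; elim: n T => // n IHn T leTn acT.
have [->|[f fT]] := set_0Vmem T; first by exists [ffun=> false] => f; rewrite inE.
have sub u v : sub_adj (T :\ f) u v -> sub_adj T u v.
  by case/sub_adjP=> d; rewrite inE => /andP[_ dT] Ed; apply/sub_adjP; exists d.
have [||b Hb] := IHn (T :\ f).
- by rewrite (cardsD1 f) fT in leTn.
- move=> c szc /andP[cyc unc]; apply: (acT c szc).
  rewrite /ucycle unc andbT; case: c {szc unc} cyc => //= a c; exact: sub_path.
have [d Ed] := dedge_surj f.
pose u := (val d).1; pose v := (val d).2.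
(* A simple path from [u] to [v] avoiding [f] has at least two edges and closes up with [f] to a
   forbidden cycle. *)
have ncon : ~~ connect (sub_adj (T :\ f)) u v.
  apply/negP=> /connectP[p0 pth0 lst0]; case/shortenP: pth0 lst0 => p pth unp _ lst.
  apply: (acT (u :: p)).
    case: p pth unp lst => [|w [|w' p]] //=.
      by move=> _ _ E; have := dart_neq d; rewrite -/u -/v E eqxx.
    rewrite andbT => /sub_adjP[d' + Ed'] _ Ew; rewrite !inE => /andP[/eqP nd' _].
    by case: nd'; rewrite -Ed; congr dedge; apply: val_inj; rewrite Ed' -Ew -surjective_pairing.
  rewrite /ucycle unp andbT /= rcons_path (sub_path sub pth) /= -lst.
  by apply/sub_adjP; exists (drev d); rewrite // dedge_drev Ed.
have csym := sym_connect_sym (@sub_adj_sym (T :\ f)).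
(* [c] is the error at [f]; flipping the component of [u] changes the coboundary at [f] but at no
   other edge of [T]. *)
pose c := coboundary b f (+) t f.
exists [ffun w => b w (+) (c && connect (sub_adj (T :\ f)) u w)] => g gT.
have [d' Ed'] := dedge_surj g.
rewrite -Ed' coboundary_dart !ffunE.
have [Eg|ng] := eqVneq g f.
  have -> : t (dedge d') = coboundary b f (+) c by rewrite Ed' Eg /c addbA addbb.
  have : dedge d = dedge d' by rewrite Ed Ed'.
  move/dedge_eq=> [->|->] /=; rewrite -/u -/v connect0 (negbTE ncon) -Ed coboundary_dart -/u -/v;
  by case: c (b u) (b v) => [] [] [].
have dT : dedge d' \in T :\ f by rewrite !inE Ed' ng.
have -> : connect (sub_adj (T :\ f)) u (val d').2 = connect (sub_adj (T :\ f)) u (val d').1.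
  rewrite ![connect _ u _]csym; apply: same_connect => //; rewrite csym; apply: connect1.
  by apply/sub_adjP; exists d' => //; rewrite -surjective_pairing.
by rewrite addbACA addbb addbF -coboundary_dart Hb.
Qed.

End Potential.

(** * Rotations of a cubic graph and the state sum of its twists *)

Section CubicGraph.

Variables (G : sgraph) (slot : dart G -> 'I_3) (dart_at : G -> 'I_3 -> dart G).
Hypothesis dtail_at : forall v i, dtail (dart_at v i) = v.
Hypothesis slot_at : forall v i, slot (dart_at v i) = i.
Hypothesis dart_atK : forall d, dart_at (dtail d) (slot d) = d.

(** The fixed reference rotation: addition in ['I_3] is modulo 3, so the slots follow each other
    cyclically. *)
Definition turn (d : dart G) : dart G := dart_at (dtail d) (slot d + 1)%R.

Lemma turn_inj : injective turn.
Proof.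
move=> d d' E; rewrite -[d]dart_atK -[d']dart_atK.
have := congr1 (@dtail G) E; rewrite !dtail_at => ->.
by have := congr1 slot E; rewrite !slot_at => /addIr ->.
Qed.

Definition turn_perm : {perm dart G} := perm turn_inj.

Lemma turn_permE d : turn_perm d = turn d. Proof. exact: permE. Qed.

Lemma turn_permVE d : (turn_perm^-1)%g d = dart_at (dtail d) (slot d - 1)%R.
Proof.
apply: (@perm_inj _ turn_perm); rewrite permKV turn_permE /turn dtail_at slot_at.
by rewrite subrK dart_atK.
Qed.

Lemma dtail_turn d : dtail (turn_perm d) = dtail d.
Proof. by rewrite turn_permE dtail_at. Qed.

Lemma dtail_turnV d : dtail ((turn_perm^-1)%g d) = dtail d.
Proof. by rewrite turn_permVE dtail_at. Qed.

Lemma turn_perm3 d : turn_perm (turn_perm d) = (turn_perm^-1)%g d.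
Proof.
rewrite !turn_permE turn_permVE /turn !dtail_at !slot_at; congr dart_at.
by apply/val_inj; case: (slot d) => -[|[|[]]].
Qed.

Lemma turn_permV2 d : (turn_perm^-1)%g ((turn_perm^-1)%g d) = turn_perm d.
Proof. by apply: (@perm_inj _ turn_perm); rewrite permKV turn_perm3. Qed.

Lemma same_tail d d' : dtail d' = dtail d ->
  [\/ d' = d, d' = turn_perm d | d' = (turn_perm^-1)%g d].
Proof.
move=> E; rewrite turn_permE turn_permVE /turn -[d']dart_atK E.
have : [\/ slot d' = slot d, slot d' = (slot d + 1)%R | slot d' = (slot d - 1)%R].
  case: (slot d) (slot d') => -[|[|[|//]]] ? [[|[|[|//]]] ?];
  by [apply: Or31; apply: val_inj | apply: Or32; apply: val_inj | apply: Or33; apply: val_inj].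
by case=> ->; [apply: Or31; rewrite dart_atK | apply: Or32 | apply: Or33].
Qed.

Lemma turn_neq d : turn_perm d != d.
Proof.
apply: contraNneq (_ : ~~ ((slot d + 1)%R == slot d)).
  by move/(congr1 slot); rewrite turn_permE slot_at => ->.
by case: (slot d) => -[|[|[]]].
Qed.

Implicit Types (b : {ffun G -> bool}) (t : {ffun edge G -> bool}).

Definition reversed b (d : dart G) : dart G :=
  if b (dtail d) then (turn_perm^-1)%g d else turn_perm d.

Lemma dtail_reversed b d : dtail (reversed b d) = dtail d.
Proof. by rewrite /reversed; case: ifP; rewrite ?dtail_turnV ?dtail_turn. Qed.

Lemma reversed_inj b : injective (reversed b).
Proof.
move=> d d' E; have := congr1 (@dtail G) E; rewrite !dtail_reversed => Et.
by move: E; rewrite /reversed Et; case: ifP => _ /perm_inj.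
Qed.

Definition reversed_perm b : {perm dart G} := perm (@reversed_inj b).

Lemma reversed_permE b d : reversed_perm b d =
  if b (dtail d) then (turn_perm^-1)%g d else turn_perm d.
Proof. exact: permE. Qed.

Lemma dtail_reversed_perm b d : dtail (reversed_perm b d) = dtail d.
Proof. by rewrite permE dtail_reversed. Qed.

Lemma reversed_permVE b d : ((reversed_perm b)^-1)%g d =
  if b (dtail d) then turn_perm d else (turn_perm^-1)%g d.
Proof.
apply: (@perm_inj _ (reversed_perm b)); rewrite permKV reversed_permE.
case Eb: (b (dtail d)); last by rewrite dtail_turnV Eb permKV.
by rewrite dtail_turn Eb permK.
Qed.

Lemma reversed_pure b : pure_rotation (reversed_perm b).
Proof.
apply/forallP=> d; apply/eqP/setP=> d'; rewrite inE; apply/idP/eqP.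
  case/porbitP=> n ->; elim: n => [|n IHn]; first by rewrite expg0 perm1.
  by rewrite expgSr permM dtail_reversed_perm.
have mem1 e : reversed_perm b e \in porbit (reversed_perm b) e by exact: (mem_porbit _ 1).
have mem2 e : reversed_perm b (reversed_perm b e) \in porbit (reversed_perm b) e.
  by have := mem_porbit (reversed_perm b) 2 e; rewrite expgS permM expg1.
move/same_tail => [->|->|->]; first exact: porbit_id.
  case Eb: (b (dtail d)); last by have := mem1 d; rewrite reversed_permE Eb.
  by have := mem2 d; rewrite !reversed_permE Eb dtail_turnV Eb turn_permV2.
case Eb: (b (dtail d)); first by have := mem1 d; rewrite reversed_permE Eb.
by have := mem2 d; rewrite !reversed_permE Eb dtail_turn Eb turn_perm3.
Qed.

(** Three darts have only two cyclic orders, so at each vertex [r] is the reference rotation or its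
    inverse. *)
Lemma pure_reversed (r : {perm dart G}) : pure_rotation r -> exists b, r = reversed_perm b.
Proof.
move=> /forallP pr.
have orb d d' : dtail d' = dtail d -> exists n, d' = iter n r d.
  move=> E; have : d' \in porbit r d by rewrite (eqP (pr d)) inE E.
  by case/porbitP=> n ->; exists n; rewrite permX.
have tl d : dtail (r d) = dtail d.
  by have := mem_porbit r 1 d; rewrite (eqP (pr d)) inE => /eqP.
have ne d : r d != d.
  apply/eqP=> rd; have [n E] := orb d (turn_perm d) (dtail_turn d).
  by have := turn_neq d; rewrite E iter_fix // eqxx.
have two d : r d = turn_perm d \/ r d = (turn_perm^-1)%g d.
  by case: (same_tail (tl d)) => E; [move: (ne d); rewrite E eqxx | left | right].
(* Otherwise [r] would exchange [d] and [turn_perm d] and never reach the third dart. *)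
have step d : r d = turn_perm d -> r (turn_perm d) = turn_perm (turn_perm d).
  move=> E; case: (two (turn_perm d)) => // E2; rewrite permK in E2.
  have [n E3] := orb d ((turn_perm^-1)%g d) (dtail_turnV d).
  have : iter n r d = d \/ iter n r d = turn_perm d.
    by elim: n {E3} => [|n [] /= ->]; [left | right | left].
  rewrite -E3 => -[] E4; first by have := turn_neq ((turn_perm^-1)%g d); rewrite permKV E4 eqxx.
  by have := turn_neq (turn_perm d); rewrite turn_perm3 E4 eqxx.
exists [ffun v => [exists d, (dtail d == v) && (r d != turn_perm d)]].
apply/permP=> d; rewrite reversed_permE ffunE; case: ifP => [/existsP[d' /andP[/eqP E nd']]|].
  case: (two d) => // rd; case/eqP: nd'.
  case: (same_tail E) => ->; first by [].
    exact: step.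
  by rewrite -turn_perm3; apply: (step _); apply: (step _).
by move/existsPn/(_ d); rewrite eqxx negbK => /eqP.
Qed.

Lemma reversed_perm_inj : injective reversed_perm.
Proof.
move=> b b' /permP E; apply/ffunP=> v; have := E (dart_at v 0%R).
rewrite !reversed_permE dtail_at.
have ne : turn_perm (dart_at v 0%R) != (turn_perm^-1)%g (dart_at v 0%R).
  by rewrite -turn_perm3 eq_sym turn_neq.
by case: (b v) (b' v) => [] [] // /eqP; rewrite ?(negbTE ne) // eq_sym (negbTE ne).
Qed.

(** Exchanging the two sides of every dart at the reversed vertices matches the corners, and matches
    the edge sides once the edges with one reversed end are toggled. *)
Lemma nfaces_reversed b t :
  nfaces ((reversed_perm b, t) : rotation_data G)
  = nfaces ((turn_perm, [ffun f => t f (+) coboundary b f]) : rotation_data G).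
Proof.
pose h (x : flag G) : flag G := (x.1, x.2 (+) b (dtail x.1)).
apply: (@nfaces_conj _ _ _ h) => [[d s]|[d s]|[d s]].
- by rewrite /h /= addbK.
- rewrite /h /across_corner /=; case: s => /=.
    rewrite dtail_reversed_perm reversed_permE.
    by case: (b (dtail d)).
  rewrite reversed_permVE; case Eb: (b (dtail d)); rewrite ?dtail_turn ?dtail_turnV Eb //.
rewrite /h /along_edge /= ffunE coboundary_dart.
by rewrite /dtail /=; case: (t _) s (b _) (b _) => [] [] [] [].
Qed.

Definition shift (e : bool) b : {ffun G -> bool} := [ffun v => e (+) b v].

Lemma coboundary_shift e b f : coboundary (shift e b) f = coboundary b f.
Proof.
have [d <-] := dedge_surj f; rewrite !coboundary_dart !ffunE.
by rewrite addbACA addbb.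
Qed.

Lemma shift_inj e : injective (shift e).
Proof. by move=> b b' /ffunP E; apply/ffunP=> v; have := E v; rewrite !ffunE => /addbI. Qed.

(* Reversing the rotation at some vertices turns every pure rotation into
   [turn_perm]. The vertices to reverse are determined up to complementation by
   the twists that this produces on the spanning tree, whence the factor 2. *)
Lemma card_T_rotation_systems (T : {set edge G}) (v0 : G) (P : pred (rotation_data G)) :
  spanning_tree T ->
  (forall b t, P (reversed_perm b, t)
               = P (turn_perm, [ffun f => t f (+) coboundary b f])) ->
  #|[set rho : rotation_data G | T_rotation_system T rho & P rho]|
  = 2 * #|[set t | P (turn_perm, t)]|.
Proof.
case=> conT acT Pinv.
(* [pot t] is the potential of [t] on the tree, normalised to be false at [v0]. *)
pose ok t := [pred b | [forall f in T, coboundary b f == t f] && ~~ b v0].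
pose pot t := odflt [ffun=> false] [pick b in ok t].
have potP t : {in T, coboundary (pot t) =1 t} /\ pot t v0 = false.
  rewrite /pot; case: pickP => [b /andP[/forallP bT /negbTE b0] | none].
    by split=> // f fT; apply/eqP/(implyP (bT f)).
  have [b bT] := acyclic_potential t acT.
  have b0 : shift (b v0) b v0 = false by rewrite ffunE addbb.
  have := none (shift (b v0) b); rewrite inE /= b0 andbT => /forallP[] f.
  by apply/implyP=> fT; rewrite coboundary_shift bT.
have pot_uniq t b : {in T, coboundary b =1 t} -> b = shift (b v0) (pot t).
  move=> bT; apply: (coboundary_inj conT) (_ : b v0 = _) => [f fT|].
    by rewrite coboundary_shift (potP t).1 ?bT.
  by rewrite ffunE (potP t).2 addbF.
(* The bit chooses between the potential and its complement; adding its coboundary cancels the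
   twists on the tree. *)
pose F (p : bool * {ffun edge G -> bool}) : rotation_data G :=
  (reversed_perm (shift p.1 (pot p.2)), [ffun f => p.2 f (+) coboundary (pot p.2) f]).
have F_inj : injective F.
  case=> e t [e' t'] [/reversed_perm_inj Eb /ffunP Et].
  have /ffunP/(_ v0) := Eb; rewrite !ffunE (potP t).2 (potP t').2 !addbF => Ee.
  rewrite Ee in Eb *; move/shift_inj: Eb => Eb; congr (_, _); apply/ffunP=> f.
  by have := Et f; rewrite !ffunE Eb => /addIb.
have <- : #|setX [set: bool] [set t | P (turn_perm, t)]| = 2 * #|[set t | P (turn_perm, t)]|.
  by rewrite cardsX cardsT card_bool.
rewrite -(card_imset _ F_inj); apply: eq_card => rho; apply/idP/imsetP.
  rewrite inE; case: rho => r t /andP[/andP[/= /pure_reversed[b ->] /forallP tT] Pr].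
  pose t' : {ffun edge G -> bool} := [ffun f => t f (+) coboundary b f].
  have bT : {in T, coboundary b =1 t'}.
    by move=> f fT; rewrite ffunE (negbTE (implyP (tT f) fT)).
  have Eb := pot_uniq t' b bT.
  exists (b v0, t'); first by rewrite !inE /= -Pinv.
  congr (_, _); first by rewrite -Eb.
  apply/ffunP=> f; rewrite !ffunE [in coboundary b]Eb coboundary_shift.
  by rewrite -addbA addbb addbF.
case=> -[e t]; rewrite !inE /= => Pt ->; apply/andP; split.
  rewrite /T_rotation_system reversed_pure; apply/forallP=> f; apply/implyP=> fT.
  by rewrite ffunE (potP t).1 // addbb.
rewrite Pinv (_ : [ffun f => _] = t) //; apply/ffunP=> f.
by rewrite !ffunE coboundary_shift -addbA addbb addbF.
Qed.

Local Open Scope ring_scope.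

(* [h (v, i)] is the colour of the corner at v between the slots i and i + 1. *)
Definition side_colours (z : nat) (h : {ffun G * 'I_3 -> 'I_z}) (d : dart G) : 'I_z * 'I_z :=
  (h (dtail d, slot d), h (dtail d, slot d - 1)).

Definition flag_colouring z (h : {ffun G * 'I_3 -> 'I_z}) : {ffun flag G -> 'I_z} :=
  [ffun x => if x.2 then (side_colours h x.1).1 else (side_colours h x.1).2].

Lemma flag_colouring_inj z : injective (@flag_colouring z).
Proof.
move=> h h' /ffunP E; apply/ffunP=> -[v i]; have := E (dart_at v i, true).
by rewrite !ffunE /= dtail_at slot_at.
Qed.

(** One summand of [edge_weight]: the indicator that both sides of the edge keep their colours from
    end to end. *)
Definition agreement z (h : {ffun G * 'I_3 -> 'I_z}) (twisted : bool) (d : dart G) : int :=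
  let p := side_colours h d in let q := side_colours h (drev d) in
  if twisted then delta p.1 q.1 * delta p.2 q.2 else delta p.1 q.2 * delta p.2 q.1.

Lemma natr_andb (a b : bool) : (a && b)%:R = a%:R * b%:R :> int.
Proof. by case: a b => [] []. Qed.

Lemma prod_natr_forall (I : finType) (P : pred I) :
  \prod_i (P i)%:R = [forall i, P i]%:R :> int.
Proof.
have [/forallP all_P | /forallPn[i nPi]] := boolP [forall i, P i].
  by rewrite big1 // => i _; rewrite all_P.
by rewrite (bigD1 i) //= (negbTE nPi) mul0r.
Qed.

Lemma agreementP z (h : {ffun G * 'I_3 -> 'I_z}) t d :
  agreement h (t (dedge d)) d =
  [forall s, flag_colouring h (along_edge (turn_perm, t) (d, s)) == flag_colouring h (d, s)]%:R.
Proof.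
rewrite /agreement /delta.
have -> (Q : pred bool) : [forall s, Q s] = Q true && Q false.
  by apply/forallP/andP => [H | [H1 H2] []].
rewrite !ffunE /=; case: (t _) => /=; rewrite natr_andb;
by congr (_ * _); congr (nat_of_bool _)%:R; rewrite eq_sym.
Qed.

Section Orientation.

Variable oriented : pred (dart G).
Hypothesis oriented_drev : forall d, oriented (drev d) = ~~ oriented d.

Lemma oriented_edge (f : edge G) : exists d, oriented d && (dedge d == f).
Proof.
have [d <-] := dedge_surj f; case od: (oriented d); first by exists d; rewrite od eqxx.
by exists (drev d); rewrite oriented_drev od dedge_drev eqxx.
Qed.

Definition rep_dart (f : edge G) : dart G := xchoose (oriented_edge f).

Lemma oriented_rep f : oriented (rep_dart f).
Proof. by case/andP: (xchooseP (oriented_edge f)). Qed.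

Lemma dedge_rep f : dedge (rep_dart f) = f.
Proof. by case/andP: (xchooseP (oriented_edge f)) => _ /eqP. Qed.

Lemma rep_dedge d : oriented d -> rep_dart (dedge d) = d.
Proof.
move=> od; have := dedge_rep (dedge d); move/esym/dedge_eq => [] // E.
by have := oriented_rep (dedge d); rewrite E oriented_drev od.
Qed.

Lemma card_oriented : #|oriented| = #|edge G|.
Proof.
have inj : injective rep_dart by exact: can_inj dedge_rep.
rewrite -(card_image inj); apply: eq_card => d; apply/idP/imageP.
  by move=> od; exists (dedge d); rewrite // rep_dedge.
by case=> f _ ->; exact: oriented_rep.
Qed.

Lemma colouring_weight z (h : {ffun G * 'I_3 -> 'I_z}) t :
  (invariant_colouring (same_face (turn_perm, t)) (flag_colouring h))%:R
  = \prod_(f : edge G) agreement h (t f) (rep_dart f).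
Proof.
pose ok d := [forall s, flag_colouring h (along_edge (turn_perm, t) (d, s))
                        == flag_colouring h (d, s)].
have -> : \prod_f agreement h (t f) (rep_dart f) = \prod_f (ok (rep_dart f))%:R.
  by apply: eq_bigr => f _; rewrite -[in t f](dedge_rep f) agreementP.
rewrite (prod_natr_forall (fun f => ok (rep_dart f))).
congr (nat_of_bool _)%:R; apply/same_face_colouringP/forallP => [inv f | oks].
  by apply/forallP=> s; apply/eqP; exact: (inv _).2.
case=> d s; split.
  rewrite /across_corner !ffunE /=; case: s => /=.
    by rewrite dtail_turn turn_permE slot_at addrK.
  by rewrite dtail_turnV turn_permVE slot_at.
have okr := forallP (oks (dedge d)).
(* If [d] is the reverse of the representative dart, the condition is read at the other end of the
   same side. *)
case: (dedge_eq (esym (dedge_rep (dedge d)))) => E; first by have /eqP := okr s; rewrite E.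
have := okr (along_edge (turn_perm, t) (d, s)).2.
rewrite E -[(drev d, _)]/(along_edge (turn_perm, t) (d, s)) along_edgeK.
by move/eqP.
Qed.

(** Each power of [z] counts invariant corner colourings. After exchanging the sums, the sum over
    all twist functions of a product over edges factors, and each edge contributes the sum over its
    two twists. *)
Lemma sum_twists_nfaces z :
  \sum_t (z%:R : int) ^+ nfaces ((turn_perm, t) : rotation_data G) =
  \sum_(h : {ffun G * 'I_3 -> 'I_z})
     \prod_(d | oriented d) edge_weight (side_colours h d) (side_colours h (drev d)).
Proof.
transitivity (\sum_(t : {ffun edge G -> bool}) \sum_(h : {ffun G * 'I_3 -> 'I_z})
    \prod_(f : edge G) agreement h (t f) (rep_dart f)).
  apply: eq_bigr => t _.
  under eq_bigr => h _ do rewrite -colouring_weight.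
  rewrite -natrX /nfaces -(card_invariant_colouring z (same_face_sym _)).
  transitivity (#|[set h : {ffun G * 'I_3 -> 'I_z}
    | invariant_colouring (same_face (turn_perm, t)) (flag_colouring h)]|%:R : int); last first.
    rewrite -sum1dep_card natr_sum big_mkcond; apply: eq_bigr => h _.
    by case: (invariant_colouring _ _).
  congr (_%:R); rewrite -(card_imset _ (@flag_colouring_inj z)); apply: eq_card => f.
  rewrite inE; apply/idP/imsetP => [inv | [h + ->]]; last by rewrite inE.
  (* Both flags of a corner have one colour, so it can be read at the successor flag. *)
  pose h : {ffun G * 'I_3 -> 'I_z} := [ffun p => f (dart_at p.1 p.2, true)].
  suff E : f = flag_colouring h by exists h; rewrite // inE -E.
  apply/ffunP=> -[d s]; rewrite ffunE /=; case: s; rewrite [h _]ffunE /= ?dart_atK //.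
  have [<- _] := (same_face_colouringP _ _ inv) (d, false).
  by rewrite /across_corner /= turn_permVE.
rewrite exchange_big; apply: eq_bigr => h _.
rewrite -(bigA_distr_bigA (fun f e => agreement h e (rep_dart f))).
rewrite (reindex_onto rep_dart (@dedge G)) /=; last exact: rep_dedge.
apply: eq_big => [f | f _]; first by rewrite oriented_rep dedge_rep eqxx.
by rewrite big_bool.
Qed.

End Orientation.

End CubicGraph.

(** * The transfer matrix *)

Section TransferPolynomials.

Local Open Scope ring_scope.

(* Coefficients of [triangle_weight], of the three products of a loop and an edge,
   and of the triple loop; the strands are the upper cycle, the spine and the
   lower cycle, and [true] adds a rung between the first two. *)
Definition transfer_state : Type :=
  ({poly int} * {poly int} * {poly int} * {poly int} * {poly int})%type.

(** The coefficients are the values of [add_rung] on the five basic tensors; for [false] the first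
    and third strands change roles. *)
Definition transfer_step (b : bool) (p : transfer_state) : transfer_state :=
  let: (p0, p1, p2, p3, p4) := p in
  if b then (('X + 4) * p0 + 2 * p1 + 2 * p2, 4 * p0, 4 * p0,
             4 * p0 + (2 * 'X + 4) * p3 + 4 * p4, 4 * p3)
  else (('X + 4) * p0 + 2 * p3 + 2 * p2, 4 * p0 + (2 * 'X + 4) * p1 + 4 * p4,
        4 * p0, 4 * p0, 4 * p1).

(** The initial state is the bare vertex v_0; [foldr] makes the head of [w] the last leaf read. *)
Definition transfer (w : seq bool) : transfer_state :=
  foldr transfer_step (1, 0, 0, 0, 0) w.

(** The fixed factors are the values of [close_up] on the five basic tensors. *)
Definition face_poly (w : seq bool) : {poly int} :=
  let: (p0, p1, p2, p3, p4) := transfer w in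
  p0 * ('X^3 + 3 * 'X^2 + 4 * 'X) + (p1 + p2 + p3) * ('X^2 + 'X) + p4 * 'X.

(* [(a1, a2, b1, b2, b3)]: after n leaves, [a1] and [a2] are the coefficients of
   degree n - 1 and n - 2 in the first transfer polynomial (of degree n), and
   [b1], [b2], [b3] those of degree n - 1 in the next three. *)
Definition profile : Type := (int * int * int * int * int)%type.

(** The leading part of [transfer_step]: a constant 4 arises from the leading coefficient 1 of the
    first polynomial, and the doubling from the entry [2 * 'X + 4]. *)
Definition profile_step (b : bool) (v : profile) : profile :=
  let: (a1, a2, b1, b2, b3) := v in
  if b then (a1 + 4, a2 + 4 * a1 + 2 * b1 + 2 * b2, 4, 4, 4 + 2 * b3)
  else (a1 + 4, a2 + 4 * a1 + 2 * b3 + 2 * b2, 4 + 2 * b1, 4, 4).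

Definition profile_of (w : seq bool) : profile :=
  foldr profile_step (0, 0, 0, 0, 0) w.

(* The factor 'X^2 keeps the subscripts of the three top coefficients nonnegative. *)
Definition has_profile (n : nat) (p : transfer_state) (v : profile) : Prop :=
  let: (p0, p1, p2, p3, p4) := p in
  let: (a1, a2, b1, b2, b3) := v in
  [/\ [/\ forall i, (p0 * 'X^2)`_(n.+3 + i) = 0, (p0 * 'X^2)`_n.+2 = 1,
          (p0 * 'X^2)`_n.+1 = a1 & (p0 * 'X^2)`_n = a2],
      forall i, (p1 * 'X^2)`_(n.+1 + i) = if i is 0%N then b1 else 0,
      forall i, (p2 * 'X^2)`_(n.+1 + i) = if i is 0%N then b2 else 0,
      forall i, (p3 * 'X^2)`_(n.+1 + i) = if i is 0%N then b3 else 0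
    & forall i, (p4 * 'X^2)`_(n.+1 + i) = 0].

Lemma coef_natM (n : nat) (p : {poly int}) i : (n%:R * p)`_i = n%:R * p`_i.
Proof. by rewrite !mulr_natl coefMn. Qed.

Lemma has_profile_transfer w : has_profile (size w) (transfer w) (profile_of w).
Proof.
elim: w => [|b w] /=.
  rewrite /has_profile /= !mul0r !mul1r.
  by split; [split=> [i|||]; rewrite coefXn ?addSn | (case=> [|i]; rewrite coef0) ..].
case: (transfer w) => [[[[p0 p1] p2] p3] p4].
case: (profile_of w) => [[[[a1 a2] b1] b2] b3].
move: (size w) => n; rewrite /has_profile; case=> [[z0 c0 c1 c2] z1 z2 z3 z4].
(* The factor ['X^2] is moved onto each polynomial, so that the remaining factors ['X] merely shift
   indices. *)
have e0 (x y : {poly int}) :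
    (('X + 4) * p0 + 2 * x + 2 * y) * 'X^2
    = 'X * (p0 * 'X^2) + 4 * (p0 * 'X^2) + 2 * (x * 'X^2) + 2 * (y * 'X^2) by ring.
have e1 (x : {poly int}) : (4 * x) * 'X^2 = 4 * (x * 'X^2) by ring.
have e3 (x : {poly int}) :
    (4 * p0 + (2 * 'X + 4) * x + 4 * p4) * 'X^2
    = 4 * (p0 * 'X^2) + 2 * ('X * (x * 'X^2)) + 4 * (x * 'X^2) + 4 * (p4 * 'X^2) by ring.
have q0 i : (p0 * 'X^2)`_(n.+2 + i) = if i is 0%N then 1 else 0.
  by case: i => [|i]; rewrite ?addn0 // addnS -addSn z0.
have tail (p : {poly int}) (v : int) :
    (forall i, (p * 'X^2)`_(n.+1 + i) = if i is 0%N then v else 0) ->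
    (p * 'X^2)`_n.+1 = v /\ forall i, (p * 'X^2)`_(n.+2 + i) = 0.
  move=> h; split=> [|i]; last by rewrite addSn -addnS h.
  by rewrite -[n.+1]addn0 h.
have [h1 t1] := tail _ _ z1.
have [h2 t2] := tail _ _ z2.
have [h3 t3] := tail _ _ z3.
have t4 i : (p4 * 'X^2)`_(n.+2 + i) = 0 by rewrite addSn -addnS z4.
have s0 : (p0 * 'X^2)`_n.+3 = 0 by rewrite -[n.+3]addn0 z0.
have s1 : (p1 * 'X^2)`_n.+2 = 0 by rewrite -[n.+2]addn0 t1.
have s2 : (p2 * 'X^2)`_n.+2 = 0 by rewrite -[n.+2]addn0 t2.
have s3 : (p3 * 'X^2)`_n.+2 = 0 by rewrite -[n.+2]addn0 t3.
have r0 i : (p0 * 'X^2)`_(n.+4 + i) = 0 by rewrite addSn -addnS z0.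
have r1 i : (p1 * 'X^2)`_(n.+3 + i) = 0 by rewrite addSn -addnS t1.
have r2 i : (p2 * 'X^2)`_(n.+3 + i) = 0 by rewrite addSn -addnS t2.
have r3 i : (p3 * 'X^2)`_(n.+3 + i) = 0 by rewrite addSn -addnS t3.
have r1' : (p1 * 'X^2)`_n.+3 = 0 by rewrite -[n.+3]addn0 r1.
have r2' : (p2 * 'X^2)`_n.+3 = 0 by rewrite -[n.+3]addn0 r2.
have r3' : (p3 * 'X^2)`_n.+3 = 0 by rewrite -[n.+3]addn0 r3.
case: b; (split; [split=> [i|||]| | | |] => [||||i|i|i|i]).
all: rewrite ?e0 ?e3 ?e1 ?coefD ?coef_natM ?coefXM /= ?addSn /= -?addSn.
all: rewrite ?s0 ?s1 ?s2 ?s3 ?r1' ?r2' ?r3' ?c0 ?c1 ?c2 ?h1 ?h2 ?h3.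
all: rewrite ?r0 ?r1 ?r2 ?r3 ?z0 ?q0 ?t1 ?t2 ?t3 ?t4.
all: try by case: i => [|i]; rewrite ?addn0 ?addnS -?addSn ?z1 ?z3 ?t1 ?t3 ?h1 ?h3; ring.
all: try ring.
all: by rewrite !(addSnnS n.+3) ?r1 ?r3 r2; ring.
Qed.

(** With n leaves, ['X^3], [3 * 'X^2] and [4 * 'X] meet the coefficients of degrees n - 2, n - 1 and
    n of the first polynomial, and ['X^2] those of degree n - 1 of the next three. *)
Lemma face_poly_coef w (a1 a2 b1 b2 b3 : int) :
  profile_of w = (a1, a2, b1, b2, b3) ->
  (face_poly w)`_(size w).+1 = a2 + 3 * a1 + 4 + b1 + b2 + b3.
Proof.
move=> Ew; have := has_profile_transfer w; rewrite Ew /face_poly.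
case: (transfer w) => [[[[p0 p1] p2] p3] p4].
move: (size w) => n; rewrite /has_profile; case=> [[z0 c0 c1 c2] z1 z2 z3 z4].
pose F : {poly int} := p0 * ('X^3 + 3 * 'X^2 + 4 * 'X) + (p1 + p2 + p3) * ('X^2 + 'X) + p4 * 'X.
rewrite -/F (_ : F`_n.+1 = (F * 'X^2)`_n.+3); last by rewrite coefMXn.
have -> : F * 'X^2 = 'X * ('X * ('X * (p0 * 'X^2))) + 3 * ('X * ('X * (p0 * 'X^2)))
   + 4 * ('X * (p0 * 'X^2)) + 'X * ('X * (p1 * 'X^2)) + 'X * (p1 * 'X^2)
   + 'X * ('X * (p2 * 'X^2)) + 'X * (p2 * 'X^2)
   + 'X * ('X * (p3 * 'X^2)) + 'X * (p3 * 'X^2) + 'X * (p4 * 'X^2) by rewrite /F; ring.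
have top2 (p : {poly int}) (v : int) :
    (forall i, (p * 'X^2)`_(n.+1 + i) = if i is 0%N then v else 0) ->
    (p * 'X^2)`_n.+1 = v /\ (p * 'X^2)`_n.+2 = 0.
  by move=> h; rewrite -[n.+2]addn1 h -[n.+1]addn0 h.
have [h1 t1] := top2 _ _ z1.
have [h2 t2] := top2 _ _ z2.
have [h3 t3] := top2 _ _ z3.
have t4 : (p4 * 'X^2)`_n.+2 = 0 by rewrite -[n.+2]addn1 z4.
by rewrite !coefD !coef_natM !coefXM /= c0 c1 c2 h1 h2 h3 t1 t2 t3 t4; ring.
Qed.

(** A prefix of [leaf_sides]; [k] still decides which block counts as the last one. *)
Definition blocks (k : nat) (m : nat -> nat) (i : nat) : seq bool :=
  flatten [seq nseq (block_size k m b) (odd b) | b <- iota 1 i].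

(** Along the run [b3 + 4] doubles at every leaf. The first leaf adds the old [2 * (b1 + b2)] to
    [a2], each of the [n] later ones adds 16, and the growth of [a1] by 4 adds up to
    [8 * n * n.+1]. *)
Lemma profile_nseq_up n (w : seq bool) (a1 a2 b1 b2 b3 : int) :
  profile_of w = (a1, a2, b1, b2, b3) ->
  profile_of (nseq n.+1 true ++ w) =
   (a1 + 4 * n.+1%:Z, a2 + 4 * a1 * n.+1%:Z + 8 * n%:Z * n.+1%:Z + 2 * (b1 + b2) + 16 * n%:Z,
    4, 4, (b3 + 4) * 2 ^+ n.+1 - 4).
Proof.
move=> Ew; elim: n => [|n IHn].
  by rewrite /= Ew; congr (_, _, _, _, _); ring.
rewrite -[LHS]/(profile_step true (profile_of (nseq n.+1 true ++ w))) IHn /=.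
by congr (_, _, _, _, _); rewrite ?exprS ?[n.+2%:Z]intS ?[n.+1%:Z]intS; ring.
Qed.

Lemma profile_nseq_down n (w : seq bool) (a1 a2 b1 b2 b3 : int) :
  profile_of w = (a1, a2, b1, b2, b3) ->
  profile_of (nseq n.+1 false ++ w) =
   (a1 + 4 * n.+1%:Z, a2 + 4 * a1 * n.+1%:Z + 8 * n%:Z * n.+1%:Z + 2 * (b3 + b2) + 16 * n%:Z,
    (b1 + 4) * 2 ^+ n.+1 - 4, 4, 4).
Proof.
move=> Ew; elim: n => [|n IHn].
  by rewrite /= Ew; congr (_, _, _, _, _); ring.
rewrite -[LHS]/(profile_step false (profile_of (nseq n.+1 false ++ w))) IHn /=.
by congr (_, _, _, _, _); rewrite ?exprS ?[n.+2%:Z]intS ?[n.+1%:Z]intS; ring.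
Qed.

(** * Solving the recursion block by block *)

Section ClosedForm.

Variables (k : nat) (m : nat -> nat).

(** Partial sums up to block [i]: [F1], [F2], [F3] are those of the final formula, and [S1] governs
    the growth of [F3]. *)
Let S1 i : int := \sum_(1 <= j < i.+1) (m j)%:Z.
Let F1 i : int := \sum_(1 <= j < i.+1)
  (- 9 + 4 * j%:Z + (- 3 + 4 * j%:Z) * (m j)%:Z + 2 * (m j)%:Z ^+ 2).
Let F2 i : int := \sum_(2 <= j < i.+1) (2 ^+ (m j + 3) + 3 * 2 ^+ (m j.-1 + 3)).
Let F3 i : int := \sum_(2 <= i' < i.+1) \sum_(1 <= j < i')
  ((m j)%:Z * (m i')%:Z + (m j)%:Z).

Lemma blocksS i :
  rev (blocks k m i.+1) = nseq (block_size k m i.+1) (odd i.+1) ++ rev (blocks k m i).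
Proof.
have Eiota : iota 1 i.+1 = iota 1 i ++ [:: i.+1] by rewrite -(addn1 i) iotaD add1n addn1.
by rewrite /blocks Eiota map_cat flatten_cat rev_cat /= cats0 rev_nseq.
Qed.

(** After an upper block the growing coefficient [c] belongs to the loop on the lower strand, after
    a lower block to the one on the upper strand. *)
Definition block_profile i (a1 a2 c : int) : profile :=
  if odd i then (a1, a2, 4, 4, c) else (a1, a2, c, 4, 4).

(** The old [c] enters [a2] once, at the first leaf of the new block; the new one starts from 4, and
    4 + 4 doubles [n.+1] times. *)
Lemma profile_block i n (a1 a2 c : int) w :
  profile_of w = block_profile i a1 a2 c ->
  profile_of (nseq n.+1 (odd i.+1) ++ w) = block_profile i.+1 (a1 + 4 * n.+1%:Z)
    (a2 + 4 * a1 * n.+1%:Z + 8 * n%:Z * n.+1%:Z + 2 * (c + 4) + 16 * n%:Z)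
    (2 ^+ (n + 4) - 4).
Proof.
have e : (4 + 4) * 2 ^+ n.+1 - 4 = 2 ^+ (n + 4) - 4 :> int.
  by rewrite exprS exprD; ring.
rewrite /block_profile oddS; case: (odd i) => Ew; rewrite [~~ _]/=.
  by rewrite (profile_nseq_down _ Ew) e.
by rewrite (profile_nseq_up _ Ew) e.
Qed.

Lemma size_leaf_sides : size (leaf_sides k m) = spine_len k m.
Proof.
rewrite size_flatten /shape -map_comp sumnE big_map /spine_len.
by rewrite /index_iota subn1; apply: eq_bigr => i _ /=; exact: size_nseq.
Qed.

Lemma S1S i : S1 i.+1 = S1 i + (m i.+1)%:Z.
Proof. by rewrite /S1 big_nat_recr. Qed.

Lemma F1S i : F1 i.+1 = F1 i +
  (- 9 + 4 * i.+1%:Z + (- 3 + 4 * i.+1%:Z) * (m i.+1)%:Z + 2 * (m i.+1)%:Z ^+ 2).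
Proof. by rewrite /F1 big_nat_recr. Qed.

Lemma F2S i : F2 i.+2 = F2 i.+1 + (2 ^+ (m i.+2 + 3) + 3 * 2 ^+ (m i.+1 + 3)).
Proof. by rewrite /F2 big_nat_recr. Qed.

Lemma F3S i : F3 i.+2 = F3 i.+1 + S1 i.+1 * ((m i.+2)%:Z + 1).
Proof.
rewrite /F3 big_nat_recr //=; congr (_ + _).
by rewrite /S1 mulr_suml; apply: eq_bigr => j _; rewrite mulrDr mulr1.
Qed.

(** An inner block j followed by another gives 4 * 2^(m_j + 3), which [F2] splits as 1 + 3. The
    correction removes the share of block [i], whose [c] has not yet entered, and 2^(m_1 + 4),
    because block 1 is one leaf shorter and starts from 0 instead of 4. *)
Lemma profile_blocks i : (0 < m 1)%N -> (0 < i < k)%N ->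
  profile_of (rev (blocks k m i)) = block_profile i (4 * (S1 i + i%:Z - 1))
    (4 * F1 i + 16 * F3 i + 4 * (S1 i + i%:Z - 2) + 8 + F2 i
     + if i == 1%N then 0 else - 2 ^+ (m 1%N + 4) - 2 ^+ (m i + 3))
    ((if i == 1%N then 2 ^+ (m 1%N + 2) else 2 ^+ (m i + 4)) - 4).
Proof.
move=> m1_gt0; elim: i => [//|[|i] IHi] /andP[_ ltik].
  rewrite blocksS /block_size eqxx /= cats0 /S1 /F1 /F2 /F3 !big_nat1 !big_geq //.
  rewrite -(prednK m1_gt0) -[nseq _ _]cats0.
  rewrite (profile_nseq_up _ (erefl : profile_of [::] = (0, 0, 0, 0, 0))).
  rewrite /block_profile /=.
  by congr (_, _, _, _, _); rewrite ?exprD ?exprS ?[_.+1%:Z]intS; ring.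
have ltik' : (0 < i.+1 < k)%N by rewrite /= (ltn_trans _ ltik).
rewrite blocksS (_ : block_size k m i.+2 = (m i.+2).+1); last first.
  by rewrite /block_size /= (ltn_eqF ltik).
rewrite (profile_block _ (IHi ltik')) (S1S i.+1) (F1S i.+1) (F2S i) (F3S i) /=.
(* The first block has its own formula, so block 2 is computed apart from the later ones. *)
by case: i {IHi ltik ltik'} => [|i]; congr (block_profile _ _ _ _);
   rewrite ?eqSS /= ?exprD ?[_.+1%:Z]intS; ring.
Qed.

(** The last block has m_k leaves rather than m_k + 1, so it is added separately; its final [c]
    supplies the remaining 2^(m_k + 3) of [F2]. The factor 2 is that of
    [card_T_rotation_systems]. *)
Lemma face_poly_leaf_sides : (2 <= k)%N ->
    (forall i, (1 <= i <= k)%N -> (1 <= m i)%N) ->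
  2 * (face_poly (rev (leaf_sides k m)))`_(spine_len k m).+1 =
    8 * F1 k + 2 * F2 k - 2 ^+ (m 1%N + 5) + 32 * F3 k.
Proof.
move=> k_ge2 m_gt0.
have m1_gt0 : (0 < m 1)%N by apply: m_gt0; rewrite /= (ltn_trans _ k_ge2).
have mk_gt0 : (0 < m k)%N by apply: m_gt0; rewrite leqnn (ltn_trans _ k_ge2).
have [j Ek] : exists j, k = j.+2 by case: (k) k_ge2 => [|[|j]] // _; exists j.
have jlt : (0 < j.+1 < k)%N by rewrite Ek ltnSn.
have Ew : rev (leaf_sides k m) = rev (blocks k m j.+2) by rewrite /leaf_sides {2}Ek.
have Eb : block_size k m j.+2 = (m k).-1.+1.
  by rewrite prednK // -Ek /block_size eqxx orbT.
have := profile_block (m k).-1 (profile_blocks m1_gt0 jlt).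
rewrite -Eb -blocksS -Ew /block_profile -size_leaf_sides -size_rev.
have -> : (m k).-1%:Z = (m k)%:Z - 1 by rewrite -[in RHS](prednK mk_gt0) intS; ring.
have -> : 2 ^+ ((m k).-1 + 4) = 2 ^+ (m k + 3) :> int.
  by rewrite -[in RHS](prednK mk_gt0) addSnnS.
have -> : (block_size k m j.+2)%:Z = (m k)%:Z by rewrite Eb prednK.
have coef a1 a2 c (w := rev (leaf_sides k m)) :
    profile_of w = (if odd j.+2 then (a1, a2, 4, 4, c) else (a1, a2, c, 4, 4)) ->
    (face_poly w)`_(size w).+1 = a2 + 3 * a1 + 12 + c.
  by case: ifP => _ Ep; rewrite (face_poly_coef Ep); ring.
move/coef => ->.
have -> : F1 k = F1 j.+2 by rewrite Ek.
have -> : F2 k = F2 j.+2 by rewrite Ek.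
have -> : F3 k = F3 j.+2 by rewrite Ek.
rewrite (F1S j.+1) (F2S j) (F3S j) (_ : m k = m j.+2); last by rewrite -Ek.
by case: j {jlt Eb Ek Ew coef} => [|j]; rewrite ?eqSS /= ?exprD ?[_.+1%:Z]intS; ring.
Qed.

End ClosedForm.

End TransferPolynomials.

(** * Numbered vertices and links of a caterpillar *)

(* Words are read backwards: the head of [w] is the side of the last leaf. The
   vertex v_0 is numbered 0, v_i is 2i - 1 and u_i is 2i; a spot is one of the
   three edge ends at a numbered vertex. *)
Definition spot : Type := (nat * 'I_3)%type.

Local Notation i0 := (@Ordinal 3 0 isT).
Local Notation i1 := (@Ordinal 3 1 isT).
Local Notation i2 := (@Ordinal 3 2 isT).

(** The loose end of the upper strand: the last leaf on that side, or v_0 while there is none. *)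
Fixpoint upper_spot (w : seq bool) : spot :=
  if w is b :: w' then if b then ((size w').*2.+2, i1) else upper_spot w' else (0, i1).

Fixpoint lower_spot (w : seq bool) : spot :=
  if w is b :: w' then if b then lower_spot w' else ((size w').*2.+2, i1) else (0, i2).

Definition spine_spot (w : seq bool) : spot :=
  if w is b :: w' then ((size w').*2.+1, i1) else (0, i0).

(** Links run from the smaller to the larger number. At vertices other than v_0, slot 0 points back,
    slot 1 forward, and slot 2 carries the rung. *)
Fixpoint links (w : seq bool) : seq (spot * spot) :=
  if w is b :: w' then
    [:: (spine_spot w', ((size w').*2.+1, i0)),
        (((size w').*2.+1, i2), ((size w').*2.+2, i2)),
        (if b then upper_spot w' else lower_spot w', ((size w').*2.+2, i0))
      & links w']
  else [::].

Definition closed_links (w : seq bool) : seq (spot * spot) :=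
  [:: (upper_spot w, ((size w).*2.+1, i1)), (spine_spot w, ((size w).*2.+1, i0)),
      (lower_spot w, ((size w).*2.+1, i2)) & links w].

Lemma spot_bounds w :
  [/\ (upper_spot w).1 < (size w).*2.+1, (spine_spot w).1 < (size w).*2.+1,
      (lower_spot w).1 < (size w).*2.+1
    & all (fun e => (e.1.1 < e.2.1) && (e.2.1 < (size w).*2.+1)) (links w)].
Proof.
elim: w => // b w /= [au bs cl /allP E]; split.
- by case: b => /=; lia.
- lia.
- by case: b => /=; lia.
- rewrite bs ltnSn !doubleS ltnSn ltnW //= !andbT; apply/andP; split.
    by case: b; lia.
  by apply/allP=> e /E; lia.
Qed.

Definition frontier w : seq spot := [:: upper_spot w; spine_spot w; lower_spot w].

(** A leaf adds the six spots of its two vertices and moves the frontier spots it uses among the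
    link ends, so up to order the old list persists. *)
Lemma uniq_link_ends w :
  uniq (map fst (links w) ++ map snd (links w) ++ frontier w).
Proof.
elim: w => // b w IHw.
pose n := (size w).*2.
pose new : seq spot := [:: (n.+1, i0); (n.+1, i1); (n.+1, i2); (n.+2, i0); (n.+2, i1); (n.+2, i2)].
rewrite (perm_uniq (_ : perm_eq _ (new ++ (map fst (links w) ++ map snd (links w) ++ frontier w)))).
  rewrite cat_uniq IHw andbT; apply/andP; split.
    by rewrite /= !inE !xpair_eqE !eqE /= !eqE /=; lia.
  apply/hasPn=> p Hp; have : p.1 < n.+1.
    have [au bs cl /allP E] := spot_bounds w.
    move: Hp; rewrite !mem_cat => /or3P[/mapP[e /E He ->]|/mapP[e /E He ->]|].
    - by case/andP: He; exact: ltn_trans.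
    - by case/andP: He.
    - by rewrite !inE => /or3P[]/eqP->.
  by apply: contraL; rewrite !inE => /or4P[/eqP->|/eqP->|/eqP->|/or3P[]/eqP->]; rewrite /=; lia.
by apply/seq.permP=> P; rewrite !count_cat /= -/n; case: b => /=; lia.
Qed.

Lemma uniq_closed_link_ends w :
  uniq (map fst (closed_links w) ++ map snd (closed_links w)).
Proof.
pose n := (size w).*2.+1.
pose new : seq spot := [:: (n, i0); (n, i1); (n, i2)].
rewrite (perm_uniq (_ : perm_eq _ (new ++ (map fst (links w) ++ map snd (links w) ++ frontier w)))).
  rewrite cat_uniq uniq_link_ends andbT; apply/andP; split.
    by rewrite /= !inE !xpair_eqE !eqE /= !eqE /=; lia.
  apply/hasPn=> p Hp; have : p.1 < n.
    have [au bs cl /allP E] := spot_bounds w.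
    move: Hp; rewrite !mem_cat => /or3P[/mapP[e /E He ->]|/mapP[e /E He ->]|].
    - by case/andP: He; exact: ltn_trans.
    - by case/andP: He.
    - by rewrite !inE => /or3P[]/eqP->.
  by apply: contraL; rewrite !inE => /or3P[]/eqP->; rewrite /=; lia.
by apply/seq.permP=> P; rewrite !count_cat /= -/n; lia.
Qed.

Definition arcs (E : seq (spot * spot)) : seq (nat * nat) := [seq (e.1.1, e.2.1) | e <- E].

Lemma uniq_arcs w : uniq (arcs (links w)).
Proof.
elim: w => // b w IHw; have [au bs cl /allP E] := spot_bounds w.
have old x y : (size w).*2.+1 <= y -> (x, y) \notin arcs (links w).
  by move=> ley; apply/mapP=> -[e /E/andP[_ +] [_ Ey]]; rewrite -Ey ltnNge ley.
rewrite /= IHw !inE !xpair_eqE !negb_or !old // andbT.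
by case: b; lia.
Qed.

Lemma frontier_parity w :
  [/\ ~~ odd (upper_spot w).1, ~~ odd (lower_spot w).1
    & odd (spine_spot w).1 = (0 < size w)].
Proof.
by elim: w => // b w /= [au al _]; case: b; rewrite /= ?odd_double ?au ?al; split.
Qed.

Lemma upper_neq_lower w : true \in w -> (upper_spot w).1 != (lower_spot w).1.
Proof.
elim: w => // b w IHw; have [au bs cl _] := spot_bounds w.
by case: b => [_|]; rewrite ?inE /=; [|move=> _]; lia.
Qed.

(** The three closing arcs start at distinct vertices: the spine end is odd, the other two are even,
    and an upper leaf keeps these apart. Thus a pair of adjacent vertices determines its link. *)
Lemma uniq_closed_arcs w : true \in w -> uniq (arcs (closed_links w)).
Proof.
move=> tw; have [au bs cl /allP E] := spot_bounds w.
have old x y : (size w).*2.+1 <= y -> (x, y) \notin arcs (links w).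
  by move=> ley; apply/mapP=> -[e /E/andP[_ +] [_ Ey]]; rewrite -Ey ltnNge ley.
have [ou ol os] := frontier_parity w.
have w_gt0 : 0 < size w by case: (w) tw.
rewrite w_gt0 in os.
have ne := upper_neq_lower tw.
rewrite /= uniq_arcs !inE !xpair_eqE !negb_or !old // !eqxx !andbT (negbTE ne).
have /negbTE-> : (upper_spot w).1 != (spine_spot w).1 by apply: contraNneq ou => ->.
have /negbTE-> // : (spine_spot w).1 != (lower_spot w).1 by apply: contraNneq ol => <-.
Qed.

Lemma size_links w : size (links w) = (3 * size w).
Proof. by elim: w => //= b w ->; lia. Qed.

Lemma size_closed_links w : size (closed_links w) = 3 * (size w).+1.
Proof. by rewrite /= size_links; lia. Qed.

(** * State sums of numbered caterpillars *)

Section TransferSum.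

Local Open Scope ring_scope.

Variable C : finType.
Implicit Types (A B Z X Y : C * C).
Local Notation z := (#|C|%:R : int).

Lemma eq_add_rung (P Q : C * C -> C * C -> int) A B :
  (forall X Y, P X Y = Q X Y) -> add_rung P A B = add_rung Q A B.
Proof.
move=> eqPQ; rewrite !add_rungE /rung_kernel.
by congr (_ + _ + _ + _);
   congr (_ * _ + _) => //; apply: eq_bigr => x _; exact: eqPQ.
Qed.

Lemma add_rungD (P Q : C * C -> C * C -> int) A B :
  add_rung (fun X Y => P X Y + Q X Y) A B = add_rung P A B + add_rung Q A B.
Proof. by rewrite !add_rungE /rung_kernel !big_split /=; ring. Qed.

Lemma add_rungZ (c : int) (P : C * C -> C * C -> int) A B :
  add_rung (fun X Y => c * P X Y) A B = c * add_rung P A B.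
Proof. by rewrite !add_rungE /rung_kernel -!mulr_sumr; ring. Qed.

Lemma horner_one (x : int) : (1 : {poly int}).[x] = 1.
Proof. by rewrite -polyC1 hornerC. Qed.

Definition tensor (p : transfer_state) A B Z : int :=
  let: (p0, p1, p2, p3, p4) := p in
  p0.[z] * triangle_weight A B Z + p1.[z] * (loop_weight A * edge_weight B Z)
  + p2.[z] * (loop_weight B * edge_weight A Z)
  + p3.[z] * (loop_weight Z * edge_weight A B)
  + p4.[z] * (loop_weight A * loop_weight B * loop_weight Z).

(** Reflection exchanges the upper and lower strands and reduces a lower leaf to an upper one. *)
Definition mirror (p : transfer_state) : transfer_state :=
  let: (p0, p1, p2, p3, p4) := p in (p0, p3, p2, p1, p4).

Lemma tensor_mirror p A B Z : tensor p A B Z = tensor (mirror p) Z B A.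
Proof.
case: p => [[[[p0 p1] p2] p3] p4]; rewrite /= (triangle_weight_rev A).
rewrite (edge_weightC B Z) (edge_weightC A Z) (edge_weightC A B).
ring.
Qed.

Lemma transfer_step_mirror b p : transfer_step b (mirror p) = mirror (transfer_step (~~ b) p).
Proof. by case: p b => [[[[p0 p1] p2] p3] p4] []. Qed.

Lemma add_rung_up p A B Z :
  add_rung (fun X Y => tensor p X Y Z) A B = tensor (transfer_step true p) A B Z.
Proof.
case: p => [[[[p0 p1] p2] p3] p4]; rewrite /tensor /=.
rewrite !add_rungD (add_rungZ p0.[_]) (add_rungZ p1.[_]) (add_rungZ p2.[_]).
rewrite (add_rungZ p3.[_]) (add_rungZ p4.[_]) add_rung_triangle add_rung_loop1 add_rung_loop2.
rewrite add_rung_loop3 add_rung_loop4.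
rewrite !(hornerD, hornerM, hornerX, horner_one).
ring.
Qed.

Lemma add_rung_down p A B Z :
  add_rung (fun X Y => tensor p A Y X) Z B = tensor (transfer_step false p) A B Z.
Proof.
rewrite (eq_add_rung (Q := fun X Y => tensor (mirror p) X Y A)); last first.
  by move=> X Y; rewrite tensor_mirror.
by rewrite add_rung_up tensor_mirror transfer_step_mirror; case: (transfer_step _ p) => [[[[]]]].
Qed.

Lemma close_upD (P Q : C * C -> C * C -> C * C -> int) :
  close_up (fun X Y Z => P X Y Z + Q X Y Z) = close_up P + close_up Q.
Proof.
rewrite /close_up -big_split; apply: eq_bigr => x _.
by rewrite -big_split; apply: eq_bigr => y _; rewrite -big_split.
Qed.

Lemma close_upZ (c : int) (P : C * C -> C * C -> C * C -> int) :
  close_up (fun X Y Z => c * P X Y Z) = c * close_up P.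
Proof.
rewrite /close_up mulr_sumr; apply: eq_bigr => x _.
by rewrite mulr_sumr; apply: eq_bigr => y _; rewrite mulr_sumr.
Qed.

Lemma close_up_tensor w : close_up (tensor (transfer w)) = (face_poly w).[z].
Proof.
rewrite /face_poly; case: (transfer w) => [[[[p0 p1] p2] p3] p4]; rewrite /tensor.
rewrite !close_upD (close_upZ p0.[_]) (close_upZ p1.[_]) (close_upZ p2.[_]).
rewrite (close_upZ p3.[_]) (close_upZ p4.[_]) close_up_triangle close_up_loop1.
rewrite close_up_loop2 close_up_loop3 close_up_loop4.
rewrite !(hornerD, hornerM, hornerXn, hornerX, horner_one).
ring.
Qed.

(** Peeling off the last entry puts the sum over the newest vertex outermost. *)
Fixpoint sum_seq (S : finType) (n : nat) (F : seq S -> int) : int :=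
  if n is n'.+1 then \sum_(x : S) sum_seq n' (fun t => F (rcons t x)) else F [::].

Lemma eq_sum_seq (S : finType) n (F G : seq S -> int) :
  (forall t, size t = n -> F t = G t) -> sum_seq n F = sum_seq n G.
Proof.
elim: n F G => [|n IHn] F G eqFG /=; first exact: eqFG.
by apply: eq_bigr => x _; apply: IHn => t st; apply: eqFG; rewrite size_rcons st.
Qed.

Lemma sum_seqZ (S : finType) n (F : seq S -> int) c :
  sum_seq n (fun t => F t * c) = sum_seq n F * c.
Proof.
by elim: n F => //= n IHn F; rewrite mulr_suml; apply: eq_bigr => x _; rewrite IHn.
Qed.

Lemma sum_seqSS (S : finType) n (F : seq S -> int) :
  sum_seq n.+2 F = \sum_u \sum_v sum_seq n (fun t => F (rcons (rcons t v) u)).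
Proof. by []. Qed.

Lemma sum_tuple (S : finType) n (F : seq S -> int) :
  \sum_(t : n.-tuple S) F t = sum_seq n F.
Proof.
elim: n F => [|n IHn] F /=.
  by rewrite (big_pred1 [tuple]) // => t; apply/esym/eqP; exact: tuple0.
under [RHS]eq_bigr => x _ do rewrite -IHn.
rewrite pair_bigA /=.
pose f (p : S * n.-tuple S) : n.+1.-tuple S := [tuple of rcons p.2 p.1].
have f_inj : injective f.
  move=> [x t] [y u] /(congr1 val)/= /rcons_inj[/val_inj -> ->] //.
rewrite (reindex f) //; apply/onW_bij/(inj_card_bij f_inj).
by rewrite card_prod !card_tuple expnS.
Qed.

Lemma sum_triple (F : C -> C -> C -> int) :
  \sum_(u : {ffun 'I_3 -> C}) F (u i0) (u i1) (u i2) = \sum_x \sum_y \sum_w F x y w.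
Proof.
under [RHS]eq_bigr => x _ do rewrite pair_bigA.
rewrite pair_bigA /=; pose f (u : {ffun 'I_3 -> C}) := (u i0, (u i1, u i2)).
have f_inj : injective f.
  move=> u v [e0 e1 e2]; apply/ffunP=> -[[|[|[|//]]] lt].
  - by rewrite (_ : Ordinal lt = i0) //; apply: val_inj.
  - by rewrite (_ : Ordinal lt = i1) //; apply: val_inj.
  - by rewrite (_ : Ordinal lt = i2) //; apply: val_inj.
rewrite [RHS](reindex f) //; apply/onW_bij/(inj_card_bij f_inj).
by rewrite !card_prod card_ffun card_ord !expnS expn0 muln1.
Qed.

Variable c0 : C.
Local Notation corners := {ffun 'I_3 -> C}.
Implicit Types (t : seq corners) (p : spot).

(** Entry n of [t] colours the three corners of vertex n; [c0] serves only beyond the end of [t]. *)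
Definition corner_colour t p : C := nth [ffun=> c0] t p.1 p.2.

Definition end_colours t p : C * C := (corner_colour t p, corner_colour t (p.1, p.2 - 1)).

Definition link_weight t (e : spot * spot) : int :=
  edge_weight (end_colours t e.1) (end_colours t e.2).

Lemma end_colours_rcons t u p :
  (p.1 < size t)%N -> end_colours (rcons t u) p = end_colours t p.
Proof. by rewrite /end_colours /corner_colour !nth_rcons => ->. Qed.

Lemma end_colours_last t u n i :
  size t = n -> end_colours (rcons t u) (n, i) = (u i, u (i - 1)).
Proof. by move=> st; rewrite /end_colours /corner_colour !nth_rcons st ltnn eqxx. Qed.

Lemma ord3B1 : [/\ i0 - 1 = i2, i1 - 1 = i0 & i2 - 1 = i1 :> 'I_3].
Proof. by split; apply: val_inj. Qed.

(** State sum of the part already read, with colours [A], [B], [Z] prescribed at the loose ends of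
    the upper, spine and lower strands. *)
Definition open_sum w A B Z : int :=
  sum_seq (size w).*2.+1 (fun t =>
    \prod_(e <- links w) link_weight t e
    * (edge_weight A (end_colours t (upper_spot w)) * edge_weight B (end_colours t (spine_spot w))
       * edge_weight Z (end_colours t (lower_spot w)))).

Lemma link_weights_rcons w t u : size t = (size w).*2.+1 ->
  \prod_(e <- links w) link_weight (rcons t u) e = \prod_(e <- links w) link_weight t e.
Proof.
move=> st; have [_ _ _ /allP E] := spot_bounds w.
apply: eq_big_seq => e /E/andP[lt1 lt2].
by rewrite /link_weight !end_colours_rcons // st //; apply: ltn_trans lt2.
Qed.

Lemma add_rung_corners (P : C * C -> C * C -> int) A B :
  add_rung P A B = \sum_(u : corners) \sum_(v : corners)
    P (u i0, u i2) (v i0, v i2) * edge_weight (v i2, v i1) (u i2, u i1)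
      * edge_weight A (u i1, u i0) * edge_weight B (v i1, v i0).
Proof.
pose Q u0 u1 u2 v0 v1 v2 := P (u0, u2) (v0, v2) * edge_weight (v2, v1) (u2, u1)
  * edge_weight A (u1, u0) * edge_weight B (v1, v0).
transitivity (\sum_(u : corners) \sum_v0 \sum_v1 \sum_v2 Q (u i0) (u i1) (u i2) v0 v1 v2).
  rewrite (sum_triple (fun u0 u1 u2 => \sum_v0 \sum_v1 \sum_v2 Q u0 u1 u2 v0 v1 v2)).
  apply: eq_bigr => u0 _; apply: eq_bigr => u1 _.
  under eq_bigr => v0 _ do rewrite exchange_big.
  by rewrite exchange_big.
by apply: eq_bigr => u _; rewrite -(sum_triple (Q (u i0) (u i1) (u i2))).
Qed.

(** Fixing the corners [u] of the new leaf and [v] of its spine vertex leaves the open sum of [w]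
    with two strands cut there; summing over them inserts the rung. *)
Lemma open_sum_cons b w A B Z : open_sum (b :: w) A B Z =
  if b then add_rung (fun X Y => open_sum w X Y Z) A B
  else add_rung (fun X Y => open_sum w A Y X) Z B.
Proof.
have [d0 d1 d2] := ord3B1.
have [ltu lts ltl _] := spot_bounds w.
rewrite {1}/open_sum [size _]/= doubleS; set n := (size w).*2.+1.
have step u v t : size t = n ->
    [/\ forall p, (p.1 < n)%N -> end_colours (rcons (rcons t v) u) p = end_colours t p,
        forall i, end_colours (rcons (rcons t v) u) (n, i) = (v i, v (i - 1)),
        forall i, end_colours (rcons (rcons t v) u) (n.+1, i) = (u i, u (i - 1))
      & \prod_(e <- links w) link_weight (rcons (rcons t v) u) e
        = \prod_(e <- links w) link_weight t e].
  move=> st; split=> [p ltp|i|i|].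
  - by rewrite !end_colours_rcons ?size_rcons ?st // ltnS ltnW.
  - by rewrite end_colours_rcons ?size_rcons ?st // end_colours_last.
  - by rewrite end_colours_last // size_rcons st.
  - apply: eq_big_seq => e; have [_ _ _ /allP E] := spot_bounds w.
    case/E/andP=> lt1 lt2; rewrite /link_weight !end_colours_rcons ?size_rcons ?st //.
    + exact: ltnW.
    + exact: ltn_trans lt1 lt2.
    + by apply: ltnW; apply: ltn_trans lt2.
rewrite sum_seqSS; case: b; rewrite add_rung_corners; apply: eq_bigr => u _;
  apply: eq_bigr => v _; rewrite /open_sum -!mulrA -sum_seqZ;
  apply: eq_sum_seq => t /(step u v)[E1 E2 E3 E4];
  rewrite /= !big_cons E4 /link_weight /= -/n !E2 !E3 !E1 // ?d0 ?d1 ?d2;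
  rewrite (edge_weightC (u i0, u i2)) (edge_weightC (v i0, v i2)); ring.
Qed.

Lemma open_sumE w A B Z : open_sum w A B Z = tensor (transfer w) A B Z.
Proof.
elim: w A B Z => [|b w IHw] A B Z; last first.
  rewrite open_sum_cons; case: b.
    rewrite -[RHS]add_rung_up; apply: eq_add_rung => X Y; exact: IHw.
  rewrite -[RHS]add_rung_down; apply: eq_add_rung => X Y; exact: IHw.
have [d0 d1 d2] := ord3B1.
transitivity (triangle_weight A B Z); last by rewrite /= !horner0 horner_one; ring.
(* At v_0 the spine leaves from slot 0 and the upper strand from slot 1, whence the exchange of the
   first two sums. *)
rewrite -triangle_weight_vertex exchange_big /=.
rewrite -(sum_triple (fun a b c => edge_weight A (b, a) * edge_weight B (a, c) * edge_weight Z (c, b))).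
apply: eq_bigr => u _; rewrite big_nil mul1r /end_colours /corner_colour /=.
by rewrite d0 d1 d2.
Qed.

Lemma closed_sumE w :
  sum_seq (size w).+1.*2 (fun t => \prod_(e <- closed_links w) link_weight t e)
  = (face_poly w).[z].
Proof.
have [d0 d1 d2] := ord3B1.
have [ltu lts ltl _] := spot_bounds w.
rewrite -close_up_tensor /close_up exchange_big /=.
rewrite -(sum_triple (fun a b c => tensor (transfer w) (b, a) (a, c) (c, b))).
set n := (size w).*2.+1.
rewrite -[LHS]/(\sum_u sum_seq n (fun t => \prod_(e <- closed_links w) link_weight (rcons t u) e)).
apply: eq_bigr => u _; rewrite -open_sumE; apply: eq_sum_seq => t st.
rewrite /closed_links !big_cons link_weights_rcons // /link_weight /= -/n.
rewrite !(end_colours_last _ _ st) d0 d1 d2 !end_colours_rcons ?st //.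
rewrite !(edge_weightC (u _, u _)); ring.
Qed.

End TransferSum.

(** * Caterpillar-Halin graphs *)

Lemma pairmap_rcons (S T : Type) (f : S -> S -> T) x s y :
  pairmap f x (rcons s y) = rcons (pairmap f x s) (f (last x s) y).
Proof. by rewrite -!cats1 pairmap_cat. Qed.

Lemma mem_pairmap_rev (S : eqType) (a b x y : S) s :
  ((a, b) \in pairmap pair y (rcons (rev s) x)) = ((b, a) \in pairmap pair x (rcons s y)).
Proof.
elim: s x => [|u s IHs] x; first by rewrite !inE !xpair_eqE andbC.
rewrite rev_cons pairmap_rcons last_rcons mem_rcons !inE IHs.
by congr (_ || _); rewrite !xpair_eqE andbC.
Qed.

(** Turns the arcs of a cycle into the list of its consecutive pairs, which can be cut into an upper
    and a lower path. *)
Lemma mem_pairmap_next (S : eqType) (x0 : S) p x y : uniq (x0 :: p) ->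
  ((x, y) \in pairmap pair x0 (rcons p x0)) = (x \in x0 :: p) && (y == next (x0 :: p) x).
Proof.
move=> unp; have sz : size (pairmap pair x0 (rcons p x0)) = (size p).+1.
  by rewrite size_pairmap size_rcons.
have nthE i : i < (size p).+1 ->
    nth (x0, x0) (pairmap pair x0 (rcons p x0)) i = (nth x0 (x0 :: p) i, nth x0 p i).
  move=> lti; rewrite (nth_pairmap x0) ?size_rcons // -rcons_cons !nth_rcons /= lti.
  by case: (ltnP i (size p)) => // le; rewrite (nth_default x0 le) if_same.
apply/idP/andP=> [/(nthP (x0, x0))[i] | [xp /eqP->]].
  rewrite sz => lti; rewrite nthE // => -[<- <-]; split; first exact: mem_nth.
  by rewrite next_nth mem_nth // index_uniq.
apply/(nthP (x0, x0)); exists (index x (x0 :: p)); first by rewrite sz index_mem.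
have lti : index x (x0 :: p) < (size p).+1 by rewrite index_mem.
by rewrite nthE // next_nth xp; congr (_, _); exact: nth_index.
Qed.

Fixpoint leaves (b : bool) (w : seq bool) : seq nat :=
  if w is c :: w' then
    if c == b then rcons (leaves b w') (size w').*2.+2 else leaves b w'
  else [::].

Definition spine_arcs n : seq (nat * nat) := [seq ((i.*2).-1, i.*2.+1) | i <- iota 0 n].
Definition rung_arcs n : seq (nat * nat) := [seq (i.*2.+1, i.*2.+2) | i <- iota 0 n].

Lemma last_leaves w :
  last 0 (leaves true w) = (upper_spot w).1 /\ last 0 (leaves false w) = (lower_spot w).1.
Proof. by elim: w => //= -[] w [IH1 IH2] /=; rewrite ?last_rcons ?IH1 ?IH2. Qed.

Lemma spine_spotE w : (spine_spot w).1 = (size w).*2.-1.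
Proof. by case: w. Qed.

Lemma mem_spine_arcsS n : spine_arcs n.+1 =i ((n.*2).-1, n.*2.+1) :: spine_arcs n.
Proof. by move=> e; rewrite /spine_arcs -addn1 iotaD map_cat mem_cat inE orbC. Qed.

Lemma mem_rung_arcsS n : rung_arcs n.+1 =i (n.*2.+1, n.*2.+2) :: rung_arcs n.
Proof. by move=> e; rewrite /rung_arcs -addn1 iotaD map_cat mem_cat inE orbC. Qed.

Lemma mem_arcs_links w e : (e \in arcs (links w)) =
  [|| e \in spine_arcs (size w), e \in rung_arcs (size w),
      e \in pairmap pair 0 (leaves true w) | e \in pairmap pair 0 (leaves false w)].
Proof.
elim: w => // b w IHw; have [lu ll] := last_leaves w.
rewrite [size _]/= mem_spine_arcsS mem_rung_arcsS /= !inE IHw spine_spotE.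
by case: b; rewrite /= pairmap_rcons mem_rcons inE ?lu ?ll /=;
   do !case: (e \in _); rewrite ?orbT ?orbF //; do !case: (e == _).
Qed.

Lemma mem_arcs_closed_links w e : (e \in arcs (closed_links w)) =
  [|| e \in spine_arcs (size w).+1, e \in rung_arcs (size w),
      e \in pairmap pair 0 (rcons (leaves true w) (size w).*2.+1)
    | e \in pairmap pair 0 (rcons (leaves false w) (size w).*2.+1)].
Proof.
have [lu ll] := last_leaves w.
rewrite !pairmap_rcons !mem_rcons mem_spine_arcsS !inE -/(arcs _) mem_arcs_links lu ll.
rewrite spine_spotE /=.
by case: (e \in spine_arcs _); case: (e \in rung_arcs _); case: (e \in pairmap _ _ _);
  case: (e \in pairmap _ _ _); case: (e == ((upper_spot w).1, _));
  case: (e == (_.-1, _)); case: (e == ((lower_spot w).1, _)).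
Qed.

Lemma leaves_rev b s :
  leaves b (rev s) = [seq i.*2.+2 | i <- iota 0 (size s) & nth false s i == b].
Proof.
elim/last_ind: s => // s c IHs; rewrite rev_rcons /= IHs size_rev size_rcons.
have -> : iota 0 (size s).+1 = rcons (iota 0 (size s)) (size s).
  by rewrite -cats1 -(addn1 (size s)) iotaD.
rewrite filter_rcons nth_rcons ltnn eqxx.
have -> : [seq i <- iota 0 (size s) | nth false (rcons s c) i == b]
        = [seq i <- iota 0 (size s) | nth false s i == b].
  by apply: eq_in_filter => i; rewrite mem_iota nth_rcons => /= ->.
by case: ifP; rewrite ?map_rcons.
Qed.

Lemma mem_spine_arcs n a b :
  ((a, b) \in spine_arcs n) = [&& odd b, b./2 < n & a == b.-2].
Proof.
apply/mapP/and3P => [[i + [-> ->]] | [ob ltb /eqP->]].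
  by rewrite mem_iota => lti; split; lia.
by exists b./2; [rewrite mem_iota | congr (_, _); lia].
Qed.

Lemma mem_rung_arcs n a b :
  ((a, b) \in rung_arcs n) = [&& odd a, a./2 < n & b == a.+1].
Proof.
apply/mapP/and3P => [[i + [-> ->]] | [oa lta /eqP->]].
  by rewrite mem_iota => lti; split; lia.
by exists a./2; [rewrite mem_iota | congr (_, _); lia].
Qed.

Lemma closed_arcs_lt w a b : (a, b) \in arcs (closed_links w) -> a < b < (size w).+1.*2.
Proof.
have [ltu lts ltl /allP E] := spot_bounds w.
rewrite doubleS !inE => /or4P[/eqP[-> ->]|/eqP[-> ->]|/eqP[-> ->]|]; rewrite ?ltu ?lts ?ltl /=; try exact: ltnSn.
by case/mapP=> e /E/andP[lt1 lt2] [-> ->]; rewrite lt1 ltnS ltnW.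
Qed.

Lemma uniq_map_inj (S T : eqType) (f : S -> T) s : uniq (map f s) -> {in s &, injective f}.
Proof.
move=> un e e' eE eE' Ef.
have idx u : u \in s -> index (f u) (map f s) = index u s.
  move=> us; have lt : index u s < size s by rewrite index_mem.
  by rewrite -{1}(nth_index u us) -(nth_map _ (f u) f lt) index_uniq ?size_map.
by rewrite -(nth_index e eE) -idx // Ef idx // nth_index.
Qed.

(** * Adjacency and darts of the Halin graph in terms of links *)

Section Halin.

Variables (k : nat) (m : nat -> nat).
Local Notation l := (spine_len k m).
Local Notation w := (rev (leaf_sides k m)).
Local Notation V := (halin_vertex k m).
Local Notation G := (caterpillar_halin k m).

(** The truncated predecessor gives v_0 the number 0. *)
Definition vertex_number (x : V) : nat :=
  match x with inl i => (val i).*2.-1 | inr j => (val j).*2.+2 end.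

Lemma vertex_number_inj : injective vertex_number.
Proof.
by move=> [[i lti]|[i lti]] [[j ltj]|[j ltj]] /= E;
   [congr inl; apply: val_inj | | | congr inr; apply: val_inj] => /=; lia.
Qed.

Lemma vertex_number_surj n : n < l.+1.*2 -> exists x, vertex_number x = n.
Proof.
move=> ltn; case on: (odd n).
  have lt : n.+1./2 < l.+2 by lia.
  by exists (inl (Ordinal lt)) => /=; lia.
case: n ltn on => [|n] ltn on; first by exists (inl ord0).
have lt : n.-1./2 < l by lia.
by exists (inr (Ordinal lt)) => /=; lia.
Qed.

Lemma tree_arcE (x y : V) : tree_arc x y =
  ((vertex_number x, vertex_number y) \in spine_arcs l.+1) || ((vertex_number x, vertex_number y) \in rung_arcs l).
Proof.
rewrite mem_spine_arcs mem_rung_arcs.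
by case: x y => [[i lti]|[i lti]] [[j ltj]|[j ltj]] /=; lia.
Qed.

Lemma vertex_number_upper_leaves : map vertex_number (upper_leaves k m) = leaves true w.
Proof.
rewrite leaves_rev size_leaf_sides -val_enum_ord filter_map -!map_comp /upper_leaves.
by congr map; apply: eq_filter => i /=; rewrite eqb_id.
Qed.

Lemma vertex_number_lower_leaves : map vertex_number (lower_leaves k m) = leaves false w.
Proof.
rewrite leaves_rev size_leaf_sides -val_enum_ord filter_map -!map_comp /lower_leaves.
by congr map; apply: eq_filter => i /=; rewrite eqbF_neg.
Qed.

Lemma uniq_halin_cycle : uniq (halin_cycle k m).
Proof.
have inr_inj : injective (@inr 'I_l.+2 'I_l) by move=> i j [].
have nu i : inl i \notin upper_leaves k m by apply/mapP=> -[].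
have nl i : inl i \notin lower_leaves k m by apply/mapP=> -[].
have disj : has (in_mem^~ (mem (upper_leaves k m))) (rev (lower_leaves k m)) = false.
  apply/hasPn=> x; rewrite mem_rev => /mapP[i + ->]; rewrite mem_filter => /andP[ni _].
  by rewrite mem_map // mem_filter (negbTE ni).
rewrite /halin_cycle /= mem_cat inE !negb_or cat_uniq /= rev_uniq !mem_rev.
by rewrite !(map_inj_uniq inr_inj) !filter_uniq ?disj ?(negbTE (nu _)) ?nu ?nl // -enumT enum_uniq.
Qed.

(** The cycle follows the upper path from v_0 to v_(l+1) and returns along the reversed lower
    path. *)
Lemma cycle_arcE (x y : V) : cycle_arc x y =
  ((vertex_number x, vertex_number y) \in pairmap pair 0 (rcons (leaves true w) l.*2.+1))
  || ((vertex_number y, vertex_number x) \in pairmap pair 0 (rcons (leaves false w) l.*2.+1)).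
Proof.
rewrite /cycle_arc -mem_pairmap_next; last exact: uniq_halin_cycle.
pose num2 (p : V * V) := (vertex_number p.1, vertex_number p.2).
have num2_inj : injective num2 by move=> [a b] [c d] [/vertex_number_inj-> /vertex_number_inj->].
rewrite -(mem_map num2_inj) -[num2 _]/(vertex_number x, vertex_number y).
have -> c p : map num2 (pairmap pair c p) = pairmap pair (vertex_number c) (map vertex_number p).
  by elim: p c => //= a p IHp c; rewrite IHp.
rewrite map_rcons map_cat /= map_rev vertex_number_upper_leaves vertex_number_lower_leaves.
rewrite rcons_cat rcons_cons -cat_rcons pairmap_cat last_rcons mem_cat.
by rewrite mem_pairmap_rev.
Qed.

Lemma halin_adjE (x y : V) : halin_adj x y =
  ((vertex_number x, vertex_number y) \in arcs (closed_links w))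
  || ((vertex_number y, vertex_number x) \in arcs (closed_links w)).
Proof.
rewrite /halin_adj; have [<-|_] := eqVneq x y.
  by apply/esym/norP; split; apply/negP=> /closed_arcs_lt; rewrite ltnn.
rewrite !mem_arcs_closed_links size_rev size_leaf_sides !tree_arcE !cycle_arcE /=.
case: (_ \in spine_arcs _); case: (_ \in spine_arcs _); rewrite ?orbT //.
case: (_ \in rung_arcs _); case: (_ \in rung_arcs _); rewrite ?orbT //.
by do 4!case: (_ \in pairmap _ _ _).
Qed.

Hypotheses (k_gt0 : 0 < k) (m1_gt0 : 0 < m 1).

Lemma mem_leaf_sides : true \in w.
Proof.
rewrite mem_rev /leaf_sides; case: k k_gt0 => // k' _ /=; rewrite mem_cat mem_nseq.
by rewrite /block_size eqxx m1_gt0.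
Qed.

Definition arc_of (d : dart G) : nat * nat := (vertex_number (val d).1, vertex_number (val d).2).

Definition forward (d : dart G) : bool := arc_of d \in arcs (closed_links w).

(** Links increase the vertex number, so exactly one of a dart and its reverse follows a link. *)
Lemma forward_drev d : forward (drev d) = ~~ forward d.
Proof.
have := halin_adjE (val d).1 (val d).2; rewrite [halin_adj _ _](valP d) -[_ \in _]/(forward d).
rewrite -[X in _ || X]/(forward (drev d)).
case fd: (forward d); case fr: (forward (drev d)) => // _.
have /andP[lt1 _] := closed_arcs_lt fd; have /andP[lt2 _] := closed_arcs_lt fr.
by have := ltn_trans lt1 lt2; rewrite ltnn.
Qed.

Lemma arc_of_inj : injective arc_of.
Proof.
move=> d d' [/vertex_number_inj e1 /vertex_number_inj e2]; apply: val_inj.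
by rewrite /= [LHS]surjective_pairing [RHS]surjective_pairing e1 e2.
Qed.

Lemma perm_forward : perm_eq [seq arc_of d | d <- enum forward] (arcs (closed_links w)).
Proof.
apply: uniq_perm; first by rewrite map_inj_uniq ?enum_uniq //; exact: arc_of_inj.
  exact: uniq_closed_arcs mem_leaf_sides.
move=> [a b]; apply/mapP/idP => [[d + ->] | ab]; first by rewrite mem_enum.
have /andP[ltab] := closed_arcs_lt ab; rewrite size_rev size_leaf_sides => ltb.
have [x Ex] := vertex_number_surj (ltn_trans ltab ltb); have [y Ey] := vertex_number_surj ltb.
have xy : @adj G x y by rewrite /= halin_adjE Ex Ey ab.
exists (exist _ (x, y) xy); last by rewrite /arc_of /= Ex Ey.
by rewrite mem_enum -[_ \in _]/(_ \in arcs _) /arc_of /= Ex Ey.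
Qed.

Lemma card_halin_edges : #|edge G| = 3 * l.+1.
Proof.
rewrite -(card_oriented forward_drev) cardE -(size_map arc_of) (perm_size perm_forward).
by rewrite size_map size_closed_links size_rev size_leaf_sides.
Qed.

Lemma card_halin_darts : #|dart G| = #|G| * 3.
Proof.
have Ef := card_oriented forward_drev; rewrite card_halin_edges in Ef.
rewrite -(cardC forward) Ef.
have -> : #|[predC forward]| = #|forward|.
  rewrite -(card_image (inv_inj (@drevK G))); apply: eq_card => d; apply/imageP/idP.
    by case=> d' + ->; rewrite !inE -[drev d' \in _]/(forward _) forward_drev.
  move=> fd; exists (drev d); rewrite ?drevK // !inE.
  by rewrite -[_ \in forward]/(forward (drev d)) forward_drev negbK.
by rewrite Ef card_sum !card_ord; lia.
Qed.

Definition link_at (a : nat * nat) : spot * spot :=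
  nth ((0, ord0), (0, ord0)) (closed_links w) (index a (arcs (closed_links w))).

Lemma link_atP a : a \in arcs (closed_links w) ->
  link_at a \in closed_links w /\ ((link_at a).1.1, (link_at a).2.1) = a.
Proof.
move=> aE; have lt : index a (arcs (closed_links w)) < size (closed_links w).
  by rewrite -(size_map (fun e : spot * spot => (e.1.1, e.2.1))) index_mem.
split; first exact: mem_nth.
rewrite -[RHS](nth_index (0, 0) aE) (nth_map ((0, ord0), (0, ord0))) //.
Qed.

Lemma link_at_arc e : e \in closed_links w -> link_at (e.1.1, e.2.1) = e.
Proof.
move=> eE; have ltE : index e (closed_links w) < size (closed_links w) by rewrite index_mem.
rewrite /link_at (_ : index _ _ = index e (closed_links w)) ?nth_index //.
rewrite -[in LHS](nth_index ((0, ord0), (0, ord0)) eE).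
rewrite -(nth_map _ (0, 0) (fun e : spot * spot => (e.1.1, e.2.1)) ltE).
by rewrite index_uniq ?size_map ?uniq_closed_arcs ?mem_leaf_sides.
Qed.

Definition spot_of (d : dart G) : spot :=
  if forward d then (link_at (arc_of d)).1 else (link_at (arc_of (drev d))).2.

Lemma spot_of1 d : (spot_of d).1 = vertex_number (dtail d).
Proof.
rewrite /spot_of; case: ifP => fd; first by have [_ []] := link_atP fd.
have fr : forward (drev d) by rewrite forward_drev fd.
by have [_ []] := link_atP fr.
Qed.

(** All link ends are distinct, so a spot determines its link and which end of it is meant. *)
Lemma spot_of_inj : injective spot_of.
Proof.
have := uniq_closed_link_ends w; rewrite cat_uniq => /and3P[un1 /hasPn dis un2].
have back d : forward d = false -> forward (drev d) by rewrite forward_drev => ->.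
have arcE a b : a \in arcs (closed_links w) -> b \in arcs (closed_links w) ->
    link_at a = link_at b -> a = b.
  by move=> /link_atP[_ {2}<-] /link_atP[_ {2}<-] ->.
have cross d d' : forward d -> forward d' = false -> spot_of d <> spot_of d'.
  move=> fd fd'; rewrite /spot_of fd fd' => E.
  have [l1 _] := link_atP fd; have [l2 _] := link_atP (back _ fd').
  have := dis _ (map_f snd l2); rewrite -E => /negP[]; exact: map_f.
move=> d d'; case fd: (forward d); case fd': (forward d') => E.
- apply: arc_of_inj; apply: (arcE) => //; move: E; rewrite /spot_of fd fd'.
  by apply: uniq_map_inj un1 _ _ _ _; apply: (link_atP _).1.
- by case: (cross d d' fd fd').
- by case: (cross d' d fd' fd).
- apply: (inv_inj (@drevK G)); apply: arc_of_inj; apply: (arcE); try exact: back.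
  move: E; rewrite /spot_of fd fd'.
  by apply: uniq_map_inj un2 _ _ _ _; apply: (link_atP (back _ _)).1.
Qed.

End Halin.

(** * The face polynomial of the Halin graph *)

Section Assembly.

Variables (k : nat) (m : nat -> nat).
Local Notation l := (spine_len k m).
Local Notation w := (rev (leaf_sides k m)).
Local Notation G := (caterpillar_halin k m).
Hypotheses (k_gt0 : 0 < k) (m1_gt0 : 0 < m 1).

Definition halin_slot (d : dart G) : 'I_3 := (spot_of d).2.

Lemma spot_ofE d : spot_of d = (vertex_number (dtail d), halin_slot d).
Proof. by rewrite [LHS]surjective_pairing spot_of1. Qed.

(** The map from darts to pairs of tail and slot is injective, and there are three darts per vertex,
    so it has an inverse. *)
Lemma halin_dart_at : exists dart_at : G -> 'I_3 -> dart G,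
  [/\ forall v i, dtail (dart_at v i) = v, forall v i, halin_slot (dart_at v i) = i
    & forall d, dart_at (dtail d) (halin_slot d) = d].
Proof.
pose f (d : dart G) : G * 'I_3 := (dtail d, halin_slot d).
have f_inj : injective f.
  move=> d d' [e1 e2]; apply: spot_of_inj.
  by rewrite !spot_ofE e1 e2.
have /inj_card_bij/(_ _)[|g fK gK] := f_inj.
  by rewrite card_prod card_ord card_halin_darts.
exists (fun v i => g (v, i)); split=> [v i|v i|d].
- by have [] := gK (v, i).
- by have [] := gK (v, i).
- exact: fK.
Qed.

Variable dart_at : G -> 'I_3 -> dart G.
Hypothesis dtail_at : forall v i, dtail (dart_at v i) = v.
Hypothesis slot_at : forall v i, halin_slot (dart_at v i) = i.
Hypothesis dart_atK : forall d, dart_at (dtail d) (halin_slot d) = d.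

Local Notation rot := (turn_perm dtail_at slot_at dart_atK).

Local Open Scope ring_scope.

(** Corner colourings are re-indexed by vertex numbers and forward darts by links, which gives the
    closed state sum. *)
Lemma halin_colouring_sum z :
  \sum_(h : {ffun G * 'I_3 -> 'I_z.+1})
     \prod_(d | forward d) edge_weight (side_colours halin_slot h d)
                                       (side_colours halin_slot h (drev d))
  = (face_poly w).[z.+1%:R].
Proof.
pose F (t : (size w).+1.*2.-tuple {ffun 'I_3 -> 'I_z.+1}) : {ffun G * 'I_3 -> 'I_z.+1} :=
  [ffun p => corner_colour ord0 t (vertex_number p.1, p.2)].
have Esz : (size w).+1.*2 = l.+1.*2 by rewrite size_rev size_leaf_sides.
have F_inj : injective F.
  move=> t u /ffunP E; apply: eq_from_tnth => j; apply/ffunP=> i.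
  have [|x Ex] := @vertex_number_surj k m j; first by rewrite -Esz.
  have := E (x, i); rewrite !ffunE /corner_colour /= Ex.
  by rewrite -!tnth_nth.
have F_bij : bijective F.
  apply: (inj_card_bij F_inj); rewrite card_tuple !card_ffun card_prod !card_ord -expnM.
  by rewrite card_sum !card_ord Esz; apply: eq_leq; congr (_ ^ _)%N; lia.
rewrite (reindex F) /=; last exact: onW_bij.
have side t d : side_colours halin_slot (F t) d = end_colours ord0 t (spot_of d).
  by rewrite /side_colours !ffunE spot_ofE.
transitivity (\sum_(t : (size w).+1.*2.-tuple {ffun 'I_3 -> 'I_z.+1})
   \prod_(e <- closed_links w) link_weight ord0 t e); last first.
  by rewrite (sum_tuple _ (fun t => \prod_(e <- _) link_weight ord0 t e)) closed_sumE card_ord.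
apply: eq_bigr => t _.
transitivity (\prod_(a <- arcs (closed_links w)) link_weight ord0 t (link_at k m a)).
  rewrite -(perm_big _ (perm_forward k_gt0 m1_gt0)) big_map big_enum /=.
  apply: eq_bigr => d fd; rewrite !side /link_weight.
  by rewrite /spot_of fd forward_drev fd drevK.
rewrite big_map; apply: eq_big_seq => e eE.
by rewrite link_at_arc.
Qed.

Lemma face_poly_halin :
  \sum_(t : {ffun edge G -> bool}) 'X^(nfaces ((rot, t) : rotation_data G)) = face_poly w.
Proof.
apply: poly_eq_natr => z; rewrite -halin_colouring_sum horner_sum.
rewrite -(sum_twists_nfaces dtail_at slot_at dart_atK (@forward_drev k m)).
by apply: eq_bigr => t _; rewrite hornerXn.
Qed.

Lemma card_twists :
  #|[set t : {ffun edge G -> bool} | nfaces ((rot, t) : rotation_data G) == l.+1]|%:R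
  = (face_poly w)`_l.+1.
Proof.
rewrite -face_poly_halin coef_sum -sum1dep_card natr_sum big_mkcond.
by apply: eq_bigr => t _; rewrite coefXn eq_sym; case: (_ == _).
Qed.

End Assembly.

(** The candidates are the torus and the Klein bottle, both of Euler characteristic 0; orientability
    selects one of them. *)
Lemma euler_genus2E (G : sgraph) (rho : rotation_data G) :
  has (embeds_in rho) (surfaces_of_genus 2) = (euler_char rho == 0%R).
Proof.
rewrite (_ : surfaces_of_genus 2 = [:: Orientable 1; NonOrientable 2]) // /= /embeds_in /=.
by move: (euler_char rho) (orientable rho) => c [] /=; rewrite ?orbF.
Qed.

Local Open Scope ring_scope.

Theorem theorem3p7 (k : nat) (m : nat -> nat) (hk : (2 <= k)%N)
    (hm : forall i : nat, (1 <= i <= k)%N -> (1 <= m i)%N)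
    (T : {set edge (caterpillar_halin k m)}) (hT : spanning_tree T) :
  (num_embeddings T 2)%:Z =
    8 * (\sum_(1 <= i < k.+1)
           (- 9 + 4 * i%:Z + (- 3 + 4 * i%:Z) * (m i)%:Z
            + 2 * (m i)%:Z ^+ 2))
    + 2 * (\sum_(2 <= i < k.+1)
             (2 ^+ (m i + 3) + 3 * 2 ^+ (m i.-1 + 3)))
    - 2 ^+ (m 1%N + 5)
    + 32 * (\sum_(2 <= i < k.+1) \sum_(1 <= j < i)
              ((m j)%:Z * (m i)%:Z + (m j)%:Z)) :> int.
Proof.
have k_gt0 : (0 < k)%N by exact: ltn_trans hk.
have m1_gt0 : (0 < m 1)%N by apply: hm.
rewrite -(face_poly_leaf_sides hk hm).
have [dart_at [E1 E2 E3]] := halin_dart_at k_gt0 m1_gt0.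
rewrite -(card_twists k_gt0 m1_gt0 E1 E2 E3).
pose P (rho : rotation_data (caterpillar_halin k m)) := nfaces rho == (spine_len k m).+1.
have -> : num_embeddings T 2 = #|[set rho | T_rotation_system T rho & P rho]|.
  apply: eq_card => rho; rewrite !inE; congr (_ && _); rewrite euler_genus2E.
  (* With 2(l + 1) vertices and 3(l + 1) edges, characteristic 0 means l + 1 faces. *)
  rewrite /euler_char /P (card_halin_edges k_gt0 m1_gt0) card_sum !card_ord.
  by move: (nfaces rho) => F; lia.
rewrite (@card_T_rotation_systems _ _ _ E1 E2 E3 T (inl ord0) P hT); last first.
  by move=> b t; rewrite /P nfaces_reversed.
by rewrite PoszM !natz.
Qed.
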